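(* Let $(A,\cdot_A,a_A)$ be a left-symmetric algebroid over $M$, let $\mathcal{V}^k(A)=\Gamma(\Lambda^kA)$, $\mathcal{V}(A)=\bigoplus_k\mathcal{V}^k(A)$, and let $\cdot_S$ be the extension of $\cdot_A$ to $\mathcal{V}(A)$ described in the context. Put $\tilde{\mathcal V}^k(A)=\mathcal V^{k+1}(A)$ and $\tilde{\mathcal V}(A)=\bigoplus_k\tilde{\mathcal V}^k(A)$. Then $(\tilde{\mathcal V}(A),\cdot_S)$ is a graded Lie-admissible algebra. Furthermore, the graded Lie bracket $$[x,y]_S=x\cdot_S y-(-1)^{(|x|-1)(|y|-1)}y\cdot_S x$$ is exactly the Schouten bracket on $\mathcal V(A)$ corresponding to the sub-adjacent Lie algebroid $(A,[\cdot,\cdot]_A,a_A)$, where $[x,y]_A=x\cdot_A y-y\cdot_A x$ for $x,y\in\Gamma(A)$.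
   Context: A left-symmetric algebra is a vector space with a bilinear product $\cdot$ such that $(x\cdot y)\cdot z-x\cdot(y\cdot z)=(y\cdot x)\cdot z-y\cdot(x\cdot z)$. A left-symmetric algebroid $(A,\cdot_A,a_A)$ is a vector bundle $A\to M$ with an ($\mathbb{R}$-bilinear) left-symmetric algebra structure $\cdot_A$ on $\Gamma(A)$ and a bundle map $a_A:A\to TM$ such that $x\cdot_A(fy)=f(x\cdot_A y)+a_A(x)(f)y$ and $(fx)\cdot_A y=f(x\cdot_A y)$ for all $f\in C^\infty(M)$, $x,y\in\Gamma(A)$. The commutator $[\cdot,\cdot]_A$ and the anchor $a_A$ make $A$ a Lie algebroid (the sub-adjacent Lie algebroid). The $\mathbb{R}$-bilinear operation $\cdot_S$ on $\mathcal V(A)$ is determined by the following rules, where $|x|=k$ for $x\in\mathcal V^k(A)$: (a) $\mathcal V^k(A)\cdot_S\mathcal V^l(A)\subset\mathcal V^{k+l-1}(A)$ (in particular $f\cdot_S g=0$ for functions $f,g$); (b) for $f\in\mathcal V^0(A)=C^\infty(M)$ and $x\in\mathcal V^1(A)$: $x\cdot_S f=a_A(x)(f)$ and $f\cdot_S x=0$; (c) $x\cdot_S y=x\cdot_A y$ for $x,y\in\mathcal V^1(A)$; (d) for homogeneous $x,y,z$: $x\cdot_S(y\wedge z)=(x\cdot_S y)\wedge z+(-1)^{(|x|-1)|y|}y\wedge(x\cdot_S z)$ and $(x\wedge y)\cdot_S z=x\wedge(y\cdot_S z)+(-1)^{(|z|-1)|y|}(x\cdot_S z)\wedge y$. A graded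 algebra is graded Lie-admissible if its graded commutator (here $[\cdot,\cdot]_S$, with $x\in\mathcal V^{|x|}(A)$ having degree $|x|-1$ in $\tilde{\mathcal V}(A)$) is a graded Lie bracket, i.e. satisfies the graded Jacobi identity. The Schouten bracket of a Lie algebroid $(A,[\cdot,\cdot]_A,a_A)$ is the unique $\mathbb{R}$-bilinear bracket of degree $-1$ on $\mathcal V(A)$ that is graded skew-symmetric, $[x,y]=-(-1)^{(|x|-1)(|y|-1)}[y,x]$, extends $[\cdot,\cdot]_A$ on $\Gamma(A)$, satisfies $[x,f]=a_A(x)(f)$ for $x\in\Gamma(A)$, $f\in C^\infty(M)$, and obeys the graded Leibniz rule $[x,y\wedge z]=[x,y]\wedge z+(-1)^{(|x|-1)|y|}y\wedge[x,z]$. *)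

(* Defs.v *)
From HB Require Import structures.
From mathcomp Require Import all_boot all_order all_algebra.
From mathcomp Require Import all_classical all_reals all_analysis.

Set Implicit Arguments.
Unset Strict Implicit.
Unset Printing Implicit Defensive.

Import Order.TTheory GRing.Theory Num.Theory.
Import numFieldNormedType.Exports.

Local Open Scope classical_set_scope.
Local Open Scope ring_scope.

(* [Ck k D f]: the map [f] is of class C^k on [D]. Only used for open [D]; the
   values of [f] outside [D] are then irrelevant. *)
Fixpoint Ck (R : realType) (V W : normedModType R) (k : nat) (D : set V)
    (f : V -> W) : Prop :=
  if k is k'.+1 then
    (forall x, D x -> differentiable f x) /\
    (forall v : V, Ck k' D (fun x => 'D_v f x))
  else forall x, D x -> {for x, continuous f}.

Definition smooth_map (R : realType) (V W : normedModType R) (D : set V)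
    (f : V -> W) : Prop :=
  forall k, Ck k D f.

(* The atlas need not be maximal. *)
Record manifold (R : realType) := Manifold {
  mcarrier :> topologicalType;
  mdim : nat;
  chart_index : Type;
  chart_dom : chart_index -> set mcarrier;
  chart_map : chart_index -> mcarrier -> 'rV[R]_mdim;
  chart_inv : chart_index -> 'rV[R]_mdim -> mcarrier;
  manifold_hausdorff : hausdorff_space mcarrier;
  manifold_second_countable : @second_countable mcarrier;
  chart_cover : forall p, exists c, chart_dom c p;
  chart_dom_open : forall c, open (chart_dom c);
  chart_img_open : forall c, open (chart_map c @` chart_dom c);
  chart_mapK : forall c p, chart_dom c p -> chart_inv c (chart_map c p) = p;
  chart_map_continuous : forall c p, chart_dom c p ->
    {for p, continuous (chart_map c)};
  chart_inv_continuous : forall c u, (chart_map c @` chart_dom c) u ->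
    {for u, continuous (chart_inv c)};
  chart_transition : forall c d,
    smooth_map (chart_map c @` (chart_dom c `&` chart_dom d))
               (chart_map d \o chart_inv c)
}.

(* [smooth_on U f]: [f] is smooth on the open set [U]. *)
Definition smooth_on (R : realType) (M : manifold R) (U : set M)
    (f : M -> R) : Prop :=
  forall c : chart_index M,
    smooth_map (chart_map c @` (U `&` chart_dom c)) (f \o chart_inv c).

Definition smooth_fun (R : realType) (M : manifold R) (f : M -> R) : Prop :=
  smooth_on setT f.

(* The tangent vectors at [p] are the derivations at [p] of C^oo(M). Such a
   [v] is only meaningful on smooth functions. *)
Record tangent_vector (R : realType) (M : manifold R) (p : M)
    (v : (M -> R) -> R) : Prop := TangentVector {
  tangent_linear : forall (a : R) (f g : M -> R),
    smooth_fun f -> smooth_fun g ->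
    v (fun q => a * f q + g q) = a * v f + v g;
  tangent_leibniz : forall f g : M -> R, smooth_fun f -> smooth_fun g ->
    v (fun q => f q * g q) = f p * v g + g p * v f
}.

(* Local trivializations are given by local frames, which are related by smooth
   transition matrices. *)
Record vector_bundle (R : realType) (M : manifold R) := VectorBundle {
  fiber :> M -> vectType R;
  rank : nat;
  triv_index : Type;
  triv_dom : triv_index -> set M;
  frame : triv_index -> forall p : M, rank.-tuple (fiber p);
  triv_cover : forall p, exists t, triv_dom t p;
  triv_dom_open : forall t, open (triv_dom t);
  frame_basis : forall t p, triv_dom t p -> basis_of fullv (frame t p);
  frame_transition : forall s t, exists2 g : 'I_rank -> 'I_rank -> M -> R,
    forall i j, smooth_on (triv_dom s `&` triv_dom t) (g i j) &
    forall p, triv_dom s p -> triv_dom t p -> forall j,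
      tnth (frame t p) j = \sum_i g i j p *: tnth (frame s p) i
}.

Definition section (R : realType) (M : manifold R) (A : vector_bundle M) :=
  forall p : M, A p.

(* Membership in Gamma(A): smooth coordinates in every local frame of the bundle
   atlas. *)
Definition smooth_section (R : realType) (M : manifold R)
    (A : vector_bundle M) (x : section A) : Prop :=
  forall t : triv_index A, exists2 g : 'I_(rank A) -> M -> R,
    forall i, smooth_on (triv_dom t) (g i) &
    forall p, triv_dom t p -> x p = \sum_i g i p *: tnth (frame t p) i.

(* A bundle map A -> TM over the identity. It is smooth iff it maps smooth
   sections to smooth vector fields, that is, to vector fields mapping C^oo(M) to
   itself. *)
Record anchor_map (R : realType) (M : manifold R) (A : vector_bundle M) :=
  AnchorMap {
    anchor_fun :> forall p : M, A p -> (M -> R) -> R;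
    anchor_tangent : forall p u, tangent_vector p (@anchor_fun p u);
    anchor_linear : forall p (a : R) (u v : A p) f, smooth_fun f ->
      anchor_fun (a *: u + v) f = a * anchor_fun u f + anchor_fun v f;
    anchor_smooth : forall (x : section A) f,
      smooth_section x -> smooth_fun f ->
      smooth_fun (fun p => anchor_fun (x p) f)
  }.

Definition anchor_act (R : realType) (M : manifold R) (A : vector_bundle M)
    (a : anchor_map A) (x : section A) (f : M -> R) : M -> R :=
  fun p => a p (x p) f.

(* Operations on Gamma(A), and later on V(A), are total functions on all
   sections; only their values on smooth sections are meaningful. *)
Definition bilinear_on (R : realType) (T : Type) (F : T -> lmodType R)
    (S : (forall p, F p) -> Prop)
    (op : (forall p, F p) -> (forall p, F p) -> forall p, F p) : Prop :=
  forall (a : R) x y z, S x -> S y -> S z ->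
    (forall p, op (fun q => a *: x q + y q) z p = a *: op x z p + op y z p) /\
    (forall p, op z (fun q => a *: x q + y q) p = a *: op z x p + op z y p).

Record left_symmetric_algebroid (R : realType) (M : manifold R)
    (A : vector_bundle M) := LeftSymmetricAlgebroid {
  lsmul : section A -> section A -> section A;
  lsanchor : anchor_map A;
  lsmul_smooth : forall x y, smooth_section x -> smooth_section y ->
    smooth_section (lsmul x y);
  lsmul_bilinear :
    bilinear_on (F := fun p => A p : lmodType R) (@smooth_section R M A) lsmul;
  lsmul_left_symmetric : forall x y z,
    smooth_section x -> smooth_section y -> smooth_section z ->
    forall p, lsmul (lsmul x y) z p - lsmul x (lsmul y z) p =
              lsmul (lsmul y x) z p - lsmul y (lsmul x z) p;
  lsmul_funr : forall f x y,
    smooth_fun f -> smooth_section x -> smooth_section y ->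
    forall p, lsmul x (fun q => f q *: y q) p =
              f p *: lsmul x y p + anchor_act lsanchor x f p *: y p;
  lsmul_funl : forall f x y,
    smooth_fun f -> smooth_section x -> smooth_section y ->
    forall p, lsmul (fun q => f q *: x q) y p = f p *: lsmul x y p
}.

Record lie_algebroid (R : realType) (M : manifold R) (A : vector_bundle M) :=
  LieAlgebroid {
    labracket : section A -> section A -> section A;
    laanchor : anchor_map A;
    labracket_smooth : forall x y, smooth_section x -> smooth_section y ->
      smooth_section (labracket x y);
    labracket_bilinear :
      bilinear_on (F := fun p => A p : lmodType R) (@smooth_section R M A)
        labracket;
    labracket_skew : forall x y, smooth_section x -> smooth_section y ->
      forall p, labracket x y p = - labracket y x p;
    labracket_jacobi : forall x y z,
      smooth_section x -> smooth_section y -> smooth_section z ->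
      forall p, labracket x (labracket y z) p + labracket y (labracket z x) p
                + labracket z (labracket x y) p = 0;
    labracket_leibniz : forall f x y,
      smooth_fun f -> smooth_section x -> smooth_section y ->
      forall p, labracket x (fun q => f q *: y q) p =
                f p *: labracket x y p + anchor_act laanchor x f p *: y p
  }.

Lemma near_eq_differentiable (R : realType) (V W : normedModType R)
    (f g : V -> W) (x : V) :
  {near x, f =1 g} -> differentiable f x -> differentiable g x.
Proof.
move=> fg df.
have gE : g \o shift x = cst (g x) + 'd f x +o_ 0 id.
  apply/eqaddoP => e e0.
  have /eqaddoP/(_ e e0) := diff_locally df.
  have : \forall h \near (0 : V), f (h + x) = g (h + x).
    by move: fg; rewrite (near_shift 0 x)/= subr0.
  have fgx : f x = g x by apply: nbhs_singleton fg.
  apply: filterS2 => h /= fgh; rewrite !fctE /= -fgh.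
  by rewrite -fgx.
have dfE := diff_unique (diff_continuous df) gE.
by apply/diff_locallyP; rewrite dfE; split => //; apply: diff_continuous.
Qed.

Lemma Ck_ext (R : realType) (V W : normedModType R) k (D : set V)
    (f g : V -> W) :
  open D -> (forall x, D x -> f x = g x) -> Ck k D f -> Ck k D g.
Proof.
move=> oD; elim: k f g => [|k IHk] f g fg /=; last first.
  have near_fg x : D x -> {near x, f =1 g}.
    move=> Dx; have : nbhs x D by apply: open_nbhs_nbhs.
    by apply: filterS => y; apply: fg.
  move=> [df Df]; split=> [x Dx|v].
    by apply: near_eq_differentiable (df _ Dx); apply: near_fg.
  by apply: IHk (Df v) => x Dx; apply: near_eq_derive; apply: near_fg.
move=> Df x Dx; have := Df x Dx; rewrite /prop_for /continuous_at -(fg _ Dx).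
apply: cvg_trans; apply: near_eq_cvg.
have : nbhs x D by apply: open_nbhs_nbhs.
by apply: filterS => y; apply: fg.
Qed.

Lemma Ck_lin (R : realType) (V : normedModType R) k (D : set V)
    (f g : V -> R) (a : R) :
  open D -> Ck k D f -> Ck k D g -> Ck k D (fun x => a * f x + g x).
Proof.
move=> oD; elim: k f g => [|k IHk] f g /=.
  move=> Df Dg x Dx; apply: continuousD; last exact: Dg.
  by apply: continuousM; [exact: cst_continuous | exact: Df].
move=> [df Df] [dg Dg]; split=> [x Dx|v].
  by apply: differentiableD (dg _ Dx); apply: differentiableZ; apply: df.
apply: Ck_ext (IHk _ _ (Df v) (Dg v)) => // x Dx; apply/esym.
have fx := diff_derivable (v := v) (df _ Dx).
have gx := diff_derivable (v := v) (dg _ Dx).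
have afx : derivable (a \*: f) x v by apply: derivableZ.
have -> : (fun x => a * f x + g x) = a \*: f + g by [].
by rewrite (deriveD afx gx) (deriveZ a fx).
Qed.

Lemma chart_img_openI (R : realType) (M : manifold R) (U : set M)
    (c : chart_index M) :
  open U -> open (chart_map c @` (U `&` chart_dom c)).
Proof.
move=> oU; rewrite openE => _ [p [Up cp] <-].
have cpI : (chart_map c @` chart_dom c) (chart_map c p) by exists p.
have : nbhs (chart_map c p) (chart_inv c @^-1` U).
  apply: (chart_inv_continuous cpI).
  by rewrite chart_mapK //; apply: open_nbhs_nbhs.
have : nbhs (chart_map c p) (chart_map c @` chart_dom c).
  by apply: open_nbhs_nbhs; split=> //; apply: chart_img_open.
rewrite /interior; apply: filterS2 => _ [q cq <-] /=; rewrite chart_mapK // => Uq.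
by exists q.
Qed.

Lemma smooth_on_lin (R : realType) (M : manifold R) (U : set M)
    (f g : M -> R) (a : R) :
  open U -> smooth_on U f -> smooth_on U g ->
  smooth_on U (fun p => a * f p + g p).
Proof.
by move=> oU fU gU c k; apply: Ck_lin (fU c k) (gU c k); apply: chart_img_openI.
Qed.

Lemma smooth_section_lin (R : realType) (M : manifold R) (A : vector_bundle M)
    (x y : section A) (a : R) :
  smooth_section x -> smooth_section y ->
  smooth_section (fun p => a *: x p + y p).
Proof.
move=> xA yA t; have [[f fU xE] [g gU yE]] := (xA t, yA t).
exists (fun i p => a * f i p + g i p) => [i|p tp].
  by apply: smooth_on_lin => //; apply: triv_dom_open.
rewrite xE // yE // scaler_sumr -big_split; apply: eq_bigr => i _ /=.
by rewrite scalerDl scalerA.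
Qed.

Section SubAdjacent.
Variables (R : realType) (M : manifold R) (A : vector_bundle M).
Variable S : left_symmetric_algebroid A.

Definition commutator (x y : section A) : section A :=
  fun p => lsmul S x y p - lsmul S y x p.

Let commutatorE x y :
  commutator x y = fun p => (-1) *: lsmul S y x p + lsmul S x y p.
Proof. by apply: functional_extensionality_dep => p; rewrite scaleN1r addrC. Qed.

Lemma commutator_smooth x y : smooth_section x -> smooth_section y ->
  smooth_section (commutator x y).
Proof.
by move=> xA yA; rewrite commutatorE; apply: smooth_section_lin;
   apply: lsmul_smooth.
Qed.

Lemma commutator_bilinear :
  bilinear_on (F := fun p => A p : lmodType R) (@smooth_section R M A)
    commutator.
Proof.
move=> a x y z xA yA zA; have H := lsmul_bilinear S a xA yA zA.
by split=> p; rewrite /commutator (H.1 p) (H.2 p) scalerBr opprD addrACA.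
Qed.

Lemma commutator_skew x y : smooth_section x -> smooth_section y ->
  forall p, commutator x y p = - commutator y x p.
Proof. by move=> _ _ p; rewrite /commutator opprB. Qed.

Let lsmulBr x y z : smooth_section x -> smooth_section y -> smooth_section z ->
  forall p, lsmul S x (commutator y z) p =
            lsmul S x (lsmul S y z) p - lsmul S x (lsmul S z y) p.
Proof.
move=> xA yA zA p; rewrite commutatorE.
have [yzA zyA] := (lsmul_smooth S yA zA, lsmul_smooth S zA yA).
by rewrite ((lsmul_bilinear S (-1) zyA yzA xA).2 p) scaleN1r addrC.
Qed.

Let lsmulBl x y z : smooth_section x -> smooth_section y -> smooth_section z ->
  forall p, lsmul S (commutator y z) x p =
            lsmul S (lsmul S y z) x p - lsmul S (lsmul S z y) x p.
Proof.
move=> xA yA zA p; rewrite commutatorE.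
have [yzA zyA] := (lsmul_smooth S yA zA, lsmul_smooth S zA yA).
by rewrite ((lsmul_bilinear S (-1) zyA yzA xA).1 p) scaleN1r addrC.
Qed.

Lemma commutator_jacobi x y z :
  smooth_section x -> smooth_section y -> smooth_section z ->
  forall p, commutator x (commutator y z) p + commutator y (commutator z x) p
            + commutator z (commutator x y) p = 0.
Proof.
move=> xA yA zA p; rewrite [commutator x _ _]/commutator.
rewrite [commutator y _ _]/commutator [commutator z _ _]/commutator.
have lsE u v w : smooth_section u -> smooth_section v -> smooth_section w ->
    lsmul S (lsmul S u v) w p - lsmul S (lsmul S v u) w p =
    lsmul S u (lsmul S v w) p - lsmul S v (lsmul S u w) p.
  move=> uA vA wA; rewrite -[lsmul S (lsmul S u v) w p](subrK
    (lsmul S u (lsmul S v w) p)) (lsmul_left_symmetric S uA vA wA p).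
  set a := lsmul S _ w p.
  by rewrite addrAC (addrAC a) subrr add0r addrC.
rewrite !lsmulBr // !lsmulBl // !lsE // !opprB !addrA.
rewrite [LHS](ACl ((1*12)*(2*7)*(3*10)*(4*5)*(6*11)*(8*9))) /=.
by rewrite !(subrr, addNr) !addr0.
Qed.

Lemma commutator_leibniz f x y :
  smooth_fun f -> smooth_section x -> smooth_section y ->
  forall p, commutator x (fun q => f q *: y q) p =
            f p *: commutator x y p + anchor_act (lsanchor S) x f p *: y p.
Proof.
move=> fM xA yA p; rewrite /commutator lsmul_funr // lsmul_funl //.
by rewrite scalerBr addrAC.
Qed.

Definition subadjacent : lie_algebroid A :=
  @LieAlgebroid R M A commutator (lsanchor S) commutator_smooth commutator_bilinear
    commutator_skew commutator_jacobi commutator_leibniz.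

End SubAdjacent.

(* The exterior algebra of [V], as the free module on the products
   e_I = e_i1 /\ ... /\ e_ik, I = {i1 < ... < ik}, of vectors of the basis
   [vbasis fullv] of [V]. *)
Definition ext (R : realType) (V : vectType R) :=
  {ffun {set 'I_(\dim (fullv : {vspace V}))} -> R}.

HB.instance Definition _ (R : realType) (V : vectType R) :=
  GRing.Lmodule.copy (ext V) {ffun {set 'I_(\dim (fullv : {vspace V}))} -> R}.

Definition inversions (n : nat) (I J : {set 'I_n}) : nat :=
  #|[pred ij : 'I_n * 'I_n |
      [&& ij.1 \in I, ij.2 \in J & (ij.2 < ij.1)%N]]|.

Section Ext.
Variables (R : realType) (V : vectType R).
Implicit Types (v w : ext V) (k : int).

Definition ext_one : ext V := [ffun I : {set _} => (#|I| == 0%N)%:R].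

(* e_I /\ e_J is (-1)^(inversions I J) e_(I U J) if I and J are disjoint and 0
   otherwise. *)
Definition ext_mul v w : ext V :=
  [ffun K : {set _} => \sum_(I : {set _} | I \subset K)
     (-1) ^+ inversions I (K :\: I) * v I * w (K :\: I)].

Definition ext_incl (u : V) : ext V :=
  [ffun I : {set _} => \sum_(i | I == finset.set1 i) coord (vbasis fullv) i u].

Definition ext_deg k v : Prop := forall I, v I != 0 -> #|I|%:Z = k.

Definition ext_comp (k : nat) v : ext V :=
  [ffun I : {set _} => if #|I| == k then v I else 0].

(* u_i1 /\ ... /\ u_ik for I = {i1 < ... < ik}. *)
Definition ext_monomial (n : nat) (u : n.-tuple V) (I : {set 'I_n}) : ext V :=
  \big[ext_mul/ext_one]_(i in I) ext_incl (tnth u i).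

End Ext.

Definition mvfield (R : realType) (M : manifold R) (A : vector_bundle M) :=
  forall p : M, ext (A p).

Section Multivectors.
Variables (R : realType) (M : manifold R) (A : vector_bundle M).
Implicit Types (x y z : mvfield A) (k l : int).

(* V(A), the smooth sections of the exterior bundle of [A]: the monomials in a
   local frame of [A] form a local frame of it. *)
Definition multivector x : Prop :=
  forall t : triv_index A, exists2 g : {set 'I_(rank A)} -> M -> R,
    forall I, smooth_on (triv_dom t) (g I) &
    forall p, triv_dom t p ->
      x p = \sum_I g I p *: ext_monomial (frame t p) I.

(* V^k(A); it is zero for k < 0. *)
Definition multivector_deg k x : Prop :=
  multivector x /\ forall p, ext_deg k (x p).

Definition mv_comp (k : nat) x : mvfield A := fun p => ext_comp k (x p).

Definition wedge x y : mvfield A := fun p => ext_mul (x p) (y p).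

Definition mv_fun (f : M -> R) : mvfield A := fun p => f p *: ext_one (A p).

Definition mv_section (u : section A) : mvfield A := fun p => ext_incl (u p).

Definition mv_bilinear (op : mvfield A -> mvfield A -> mvfield A) : Prop :=
  bilinear_on (F := fun p => ext (A p) : lmodType R) multivector op.

Record schouten_extension (S : left_symmetric_algebroid A)
    (op : mvfield A -> mvfield A -> mvfield A) : Prop := SchoutenExtension {
  se_bilinear : mv_bilinear op;
  se_degree : forall k l x y, multivector_deg k x -> multivector_deg l y ->
    multivector_deg (k + l - 1) (op x y);
  se_section_fun : forall u f, smooth_section u -> smooth_fun f ->
    forall p, op (mv_section u) (mv_fun f) p =
              mv_fun (anchor_act (lsanchor S) u f) p;
  se_fun_section : forall u f, smooth_section u -> smooth_fun f ->
    forall p, op (mv_fun f) (mv_section u) p = 0;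
  se_section : forall u v, smooth_section u -> smooth_section v ->
    forall p, op (mv_section u) (mv_section v) p = mv_section (lsmul S u v) p;
  se_leibniz_r : forall k l m x y z, multivector_deg k x ->
    multivector_deg l y -> multivector_deg m z ->
    forall p, op x (wedge y z) p =
      wedge (op x y) z p + (-1) ^ ((k - 1) * l) *: wedge y (op x z) p;
  se_leibniz_l : forall k l m x y z, multivector_deg k x ->
    multivector_deg l y -> multivector_deg m z ->
    forall p, op (wedge x y) z p =
      wedge x (op y z) p + (-1) ^ ((m - 1) * l) *: wedge (op x z) y p
}.

(* The degree k part V^(k+1)(A) of the shifted space. *)
Definition shifted_deg k x : Prop := multivector_deg (k + 1) x.

Definition graded_algebra (op : mvfield A -> mvfield A -> mvfield A) : Prop :=
  mv_bilinear op /\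
  forall i j x y, shifted_deg i x -> shifted_deg j y ->
    shifted_deg (i + j) (op x y).

Record graded_lie_bracket (br : mvfield A -> mvfield A -> mvfield A) : Prop :=
  GradedLieBracket {
    glb_graded : graded_algebra br;
    glb_skew : forall i j x y, shifted_deg i x -> shifted_deg j y ->
      forall p, br x y p = - ((-1) ^ (i * j) *: br y x p);
    glb_jacobi : forall i j k x y z,
      shifted_deg i x -> shifted_deg j y -> shifted_deg k z ->
      forall p, (-1) ^ (i * k) *: br x (br y z) p
                + (-1) ^ (j * i) *: br y (br z x) p
                + (-1) ^ (k * j) *: br z (br x y) p = 0
  }.

(* The bilinear extension of the graded commutator of homogeneous elements, see
   [graded_commutatorE]. *)
Definition graded_commutator (op : mvfield A -> mvfield A -> mvfield A) x y :
    mvfield A :=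
  fun p => \sum_(k < (rank A).+1) \sum_(l < (rank A).+1)
    (op (mv_comp k x) (mv_comp l y) p
     - (-1) ^ ((k%:Z - 1) * (l%:Z - 1)) *: op (mv_comp l y) (mv_comp k x) p).

Definition graded_lie_admissible (op : mvfield A -> mvfield A -> mvfield A) :
    Prop :=
  graded_algebra op /\ graded_lie_bracket (graded_commutator op).

Record schouten_axioms (L : lie_algebroid A)
    (br : mvfield A -> mvfield A -> mvfield A) : Prop := SchoutenAxioms {
  sb_bilinear : mv_bilinear br;
  sb_degree : forall k l x y, multivector_deg k x -> multivector_deg l y ->
    multivector_deg (k + l - 1) (br x y);
  sb_skew : forall k l x y, multivector_deg k x -> multivector_deg l y ->
    forall p, br x y p = - ((-1) ^ ((k - 1) * (l - 1)) *: br y x p);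
  sb_section : forall u v, smooth_section u -> smooth_section v ->
    forall p, br (mv_section u) (mv_section v) p =
              mv_section (labracket L u v) p;
  sb_section_fun : forall u f, smooth_section u -> smooth_fun f ->
    forall p, br (mv_section u) (mv_fun f) p =
              mv_fun (anchor_act (laanchor L) u f) p;
  sb_leibniz : forall k l m x y z, multivector_deg k x ->
    multivector_deg l y -> multivector_deg m z ->
    forall p, br x (wedge y z) p =
      wedge (br x y) z p + (-1) ^ ((k - 1) * l) *: wedge y (br x z) p
}.

Definition is_schouten_bracket (L : lie_algebroid A)
    (br : mvfield A -> mvfield A -> mvfield A) : Prop :=
  schouten_axioms L br /\
  forall br', schouten_axioms L br' ->
    forall x y, multivector x -> multivector y ->
    forall p, br' x y p = br x y p.

Lemma multivector_lin (a : R) x y : multivector x -> multivector y ->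
  multivector (fun p => a *: x p + y p).
Proof.
move=> xA yA t; have [[f fU xE] [g gU yE]] := (xA t, yA t).
exists (fun I p => a * f I p + g I p) => [I|p tp].
  by apply: smooth_on_lin => //; apply: triv_dom_open.
rewrite xE // yE // scaler_sumr -big_split; apply: eq_bigr => I _ /=.
by rewrite scalerDl scalerA.
Qed.

Let oppDE x : (fun q => -1 *: x q + x q) = fun=> 0.
Proof.
by apply: functional_extensionality_dep => q; rewrite scaleN1r addNr.
Qed.

Let op0l (op : mvfield A -> mvfield A -> mvfield A) x y : mv_bilinear op ->
  multivector x -> multivector y -> forall p, op (fun=> 0) y p = 0.
Proof.
move=> opB xA yA p; have [/(_ p) + _] := opB (-1) x x y xA xA yA.
by rewrite oppDE scaleN1r addNr.
Qed.

Let op0r (op : mvfield A -> mvfield A -> mvfield A) x y : mv_bilinear op ->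
  multivector x -> multivector y -> forall p, op y (fun=> 0) p = 0.
Proof.
move=> opB xA yA p; have [_ /(_ p)] := opB (-1) x x y xA xA yA.
by rewrite oppDE scaleN1r addNr.
Qed.

Let mv_compE k x (j : nat) : multivector_deg k x ->
  mv_comp j x = if j%:Z == k then x else fun=> 0.
Proof.
move=> [_ xk]; apply: functional_extensionality_dep => p; apply/ffunP => I.
have x0 : #|I|%:Z != k -> x p I = 0.
  by move=> Ik; apply/eqP; apply: contraNT Ik => xI; rewrite (xk _ _ xI).
rewrite ffunE; have [<-|Ij] := eqVneq #|I| j.
  by have [//|/x0->] := eqVneq; rewrite ffunE.
have [jk|_] := eqVneq; last by rewrite ffunE.
by rewrite x0 // -jk eqz_nat.
Qed.

Let multivector_eq0 k x : (forall j : 'I_(rank A).+1, j%:Z != k) ->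
  multivector_deg k x -> x = fun=> 0.
Proof.
move=> kA [_ xk]; apply: functional_extensionality_dep => p.
apply/ffunP => I; rewrite ffunE; apply/eqP; apply/negP => /negP xI.
have dimE : \dim (fullv : {vspace A p}) = rank A.
  have [t tp] := triv_cover A p.
  by rewrite -(size_basis (frame_basis tp)).
have Ile : (#|I| < (rank A).+1)%N.
  by rewrite ltnS -dimE -[leqRHS]card_ord max_card.
by have := kA (Ordinal Ile); rewrite -(xk _ _ xI) eqxx.
Qed.

Lemma graded_commutatorE (op : mvfield A -> mvfield A -> mvfield A) k l x y :
  mv_bilinear op -> multivector_deg k x -> multivector_deg l y ->
  forall p, graded_commutator op x y p =
            op x y p - (-1) ^ ((k - 1) * (l - 1)) *: op y x p.
Proof.
move=> opB xk yl p; rewrite /graded_commutator.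
have [xA _] := xk; have [yA _] := yl.
have mv0 : multivector (fun=> 0).
  by rewrite -(oppDE x); apply: multivector_lin.
pose F (i j : nat) := op (mv_comp i x) (mv_comp j y) p
  - (-1) ^ ((i%:Z - 1) * (j%:Z - 1)) *: op (mv_comp j y) (mv_comp i x) p.
pose G := op x y p - (-1) ^ ((k - 1) * (l - 1)) *: op y x p.
have FE i j : F i j = if (i%:Z == k) && (j%:Z == l) then G else 0.
  rewrite /F (mv_compE _ xk) (mv_compE _ yl).
  have [->|_] := eqVneq i%:Z k; have [->|_] := eqVneq j%:Z l => //=;
    by rewrite ?(op0l opB (x := x)) ?(op0r opB (x := x)) // scaler0 subr0.
rewrite -[RHS]/G.
transitivity (\sum_(i < (rank A).+1) \sum_(j < (rank A).+1) F i j) => [//|].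
under eq_bigr do under eq_bigr do rewrite FE.
have G0l : (x = fun=> 0) -> G = 0.
  by move=> x0; rewrite /G x0 (op0l opB mv0) // (op0r opB mv0) // scaler0 subr0.
have G0r : (y = fun=> 0) -> G = 0.
  by move=> y0; rewrite /G y0 (op0l opB mv0) // (op0r opB mv0) // scaler0 subr0.
have [/existsP[i /eqP ik]|/existsPn xn] :=
    boolP [exists i : 'I_(rank A).+1, i%:Z == k]; last first.
  rewrite (G0l (multivector_eq0 xn xk)) big1 // => i _; rewrite big1 // => j _.
  by case: ifP.
have [/existsP[j /eqP jl]|/existsPn yn] :=
    boolP [exists j : 'I_(rank A).+1, j%:Z == l]; last first.
  rewrite (G0r (multivector_eq0 yn yl)) big1 // => i' _; rewrite big1 // => j' _.
  by case: ifP.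
rewrite (bigD1 i) //= [X in _ + X]big1 ?addr0 => [|i' i'i].
  rewrite (bigD1 j) //= ik jl !eqxx big1 ?addr0 // => j' j'j.
  by rewrite -jl eqz_nat val_eqE (negPf j'j).
rewrite big1 // => j' _.
by rewrite -ik eqz_nat val_eqE (negPf i'i).
Qed.

End Multivectors.

(* Main.v *)
(* By the two Leibniz rules of the product, the graded commutator obeys the
   Leibniz rule of the Schouten bracket in its second argument, so that [x, -] is
   a graded derivation of the wedge product. A graded derivation which vanishes
   on functions and sections is zero: at a given point p, multiply a multivector
   by a power of a bump function at p to write it as a sum of products of
   globally defined functions and sections. This gives the uniqueness of the
   bracket, using skew symmetry for its first argument. It also gives the Jacobi
   identity: the Jacobiator is a derivation in its last argument and invariant
   under cyclic permutations, which reduces the identity to functions and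
   sections. There it says that the sub-adjacent bracket is a Lie bracket and
   that the anchor is a morphism. *)

Require Import Defs.
From HB Require Import structures.
From mathcomp Require Import all_boot all_order all_algebra.
From mathcomp Require Import all_classical all_reals all_analysis.
From mathcomp Require Import ring zify.

Set Implicit Arguments.
Unset Strict Implicit.
Unset Printing Implicit Defensive.

Import Order.TTheory GRing.Theory Num.Theory.
Import numFieldNormedType.Exports.

Local Open Scope classical_set_scope.
Local Open Scope ring_scope.

(** * Smooth bump functions *)

(** The operations in the statement are maps on global fields and nothing says that they are local,
    so a computation in a local frame cannot be fed to them directly; this is what forces global
    cutoffs. A second obstacle is the encoding of the exterior algebra: that of a fibre is written
    in the basis [vbasis fullv], which varies with the point without any continuity. Smoothness is
    therefore always read off from monomials in a frame. This is stable under the wedge product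
    because the constants that turn a product of two monomials into a multiple of a monomial depend
    on the indices only, not on the fibre. The Jacobi identity and uniqueness are proved for every
    bracket that satisfies [schouten_axioms]; for the bracket, the given product enters only when
    these axioms are checked for its graded commutator. *)

Section FlatFunctions.
Variable R : realType.
Implicit Types (P : {poly R}) (s : R).

(* This family, indexed by the polynomial P, is closed under differentiation, so
   its members are smooth, also at 0. *)
Definition flat P (s : R) : R :=
  if 0 < s then P.[s^-1] * expR (- s^-1) else 0.

(** For s > 0, the derivative of P(1/s) exp(-1/s) is s^-2 (P - P')(1/s) exp(-1/s). *)
Definition flat_derive P : {poly R} := (P - P^`()) * 'X^2.

Lemma flat_le0 P s : s <= 0 -> flat P s = 0.
Proof. by rewrite /flat leNgt; case: ltP. Qed.

(** The exponential at 1/s dominates the term of degree n+1 of its series; the bound is the inverse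
    of this. *)
Lemma expRN_inv_le s n : 0 < s ->
  expR (- s^-1) <= n.+1`!%:R * s ^+ n.+1.
Proof.
move=> s0; have sV0 : 0 < s^-1 by rewrite invr_gt0.
rewrite expRN -[leRHS]invrK lef_pV2 ?posrE ?expR_gt0 //; last first.
  by rewrite invr_gt0 mulr_gt0 ?exprn_gt0 // ltr0n fact_gt0.
apply: le_trans (expR_ge1Dxn n (ltW sV0)).
by rewrite invfM -exprVn mulrC lerDr.
Qed.

(** A quadratic bound is what makes the difference quotient at 0 tend to 0. *)
Lemma flat_bound P : exists C, forall s, `|flat P s| <= C * s ^+ 2.
Proof.
(* The coefficient of index i comes with s^-i, so the exponential is bounded by (i+2)! s^(i+2) to
   leave s^2. *)
exists (\sum_(i < size P) `|P`_i| * i.+2`!%:R) => s.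
rewrite /flat; case: ifP => [s0|_]; last first.
  by rewrite normr0; apply: mulr_ge0; [apply: sumr_ge0|exact: sqr_ge0].
rewrite horner_coef normrM (ger0_norm (expR_ge0 _)).
apply: (@le_trans _ _ (\sum_(i < size P) `|P`_i * s^-1 ^+ i| * expR (- s^-1))).
  by rewrite -mulr_suml ler_wpM2r ?expR_ge0 // ler_norm_sum.
rewrite mulr_suml; apply: ler_sum => i _.
rewrite normrM -!mulrA ler_wpM2l //.
rewrite ger0_norm; last by rewrite exprn_ge0 // invr_ge0 ltW.
rewrite exprVn ler_pdivrMl ?exprn_gt0 //.
apply: le_trans (expRN_inv_le i.+1 s0) _.
by rewrite [leRHS]mulrCA -exprD addn2.
Qed.

Lemma is_derive_flat P s : is_derive s 1 (flat P) (flat (flat_derive P) s).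
Proof.
have [s0|s0|->] := ltgtP s 0.
- rewrite flat_le0 1?ltW //; apply: near_eq_is_derive (is_derive_cst 0 s 1) => //.
  by near=> u; rewrite flat_le0 // ltW //; near: u; apply: lt_nbhsl.
- have sN0 : s != 0 by rewrite gt_eqF.
  pose g u := P.[u^-1] * expR (- u^-1).
  have : is_derive s 1 g (flat (flat_derive P) s).
    have dV : is_derive s 1 (fun u : R => u^-1) (- s ^- 2).
      apply: DeriveDef; first exact: derivableV.
      by rewrite deriveV // derive_id [_ *: _]mulr1.
    have dP : is_derive s 1 (horner P \o (fun u : R => u^-1))
        (P^`().[s^-1] * (- s ^- 2)).
      by apply: is_derive1_comp.
    have dN : is_derive s 1 (expR \o (fun u : R => - u^-1))
        (expR (- s^-1) * (s ^- 2)).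
      apply: is_derive1_comp.
      by rewrite -[s ^- 2]opprK; apply: is_deriveN.
    apply: is_derive_eq (is_deriveM dP dN) _.
    rewrite /flat s0 /flat_derive hornerM hornerD hornerN hornerXn /=.
    by rewrite /GRing.scale /= exprVn; ring.
  apply: near_eq_is_derive => //.
  near=> u; rewrite /flat /g ifT //; near: u; exact: lt_nbhsr.
(* At 0 the slope function is [flat P z / z], which is at most C |z| in absolute value and so
   extends continuously by 0. *)
- have [C CP] := flat_bound P.
  rewrite flat_le0 //; apply/is_derive1_caratheodory.
  exists (fun z => if z == 0 then 0 else flat P z / z); split.
  + move=> z; rewrite [flat P 0]flat_le0 // !subr0.
    by case: eqVneq => [->|z0]; [rewrite flat_le0 ?mulr0|rewrite divfK].
  + rewrite /prop_for /continuous_at eqxx.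
    have H : C * `|z| @[z --> (0 : R)] --> (0 : R).
      rewrite -[X in _ --> X](mulr0 C); apply: cvgMl_tmp.
      by have := @norm_continuous _ R 0; rewrite /continuous_at normr0.
    apply/cvgr0Pnorm_le => e e0.
    have /cvgr0Pnorm_le/(_ _ e0) := H.
    apply: filterS => z; apply: le_trans.
    case: eqVneq => [->|z0]; first by rewrite normr0.
    rewrite normrM normfV ler_pdivrMr ?normr_gt0 //.
    apply: le_trans (CP z) _.
    rewrite -real_normK ?num_real // expr2 mulrA ler_wpM2r //.
    exact: ler_norm.
  + by rewrite eqxx.
Unshelve. all: by end_near. Qed.

End FlatFunctions.

(** * Maps of class C^k, and bump functions on R^n *)

Section CkCalculus.
Variable R : realType.
Implicit Types (V W : normedModType R) (k : nat).

Lemma CkS V W k (D D' : set V) (f : V -> W) :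
  D' `<=` D -> Ck k D f -> Ck k D' f.
Proof.
move=> DD'; elim: k f => [|k IHk] f /=; first by move=> Df x /DD'/Df.
by move=> [df Df]; split=> [x /DD'/df|v] //; apply: IHk.
Qed.

Lemma CkU V W k (D D' : set V) (f : V -> W) :
  Ck k D f -> Ck k D' f -> Ck k (D `|` D') f.
Proof.
elim: k f => [|k IHk] f /=; first by move=> Df D'f x [/Df|/D'f].
by move=> [df Df] [d'f D'f]; split=> [x [/df|/d'f]|v] //; apply: IHk.
Qed.

Lemma CkW V W k (D : set V) (f : V -> W) : Ck k.+1 D f -> Ck k D f.
Proof.
elim: k f => [|k IHk] f [df Df].
  by move=> x /df; apply: differentiable_continuous.
by split=> // v; apply: IHk.
Qed.

Lemma Ck_cst V W k (D : set V) (a : W) : Ck k D (fun=> a).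
Proof.
elim: k a => [|k IHk] a /=; first by move=> x _; apply: cst_continuous.
split=> [x _|v]; first exact: differentiable_cst.
suff -> : (fun x => 'D_v (fun _ : V => a) x) = fun=> 0 by [].
by apply/funext => x; apply: derive_cst.
Qed.

Lemma Ck_mul V k (D : set V) (f g : V -> R) : open D ->
  Ck k D f -> Ck k D g -> Ck k D (fun x => f x * g x).
Proof.
move=> oD; elim: k f g => [|k IHk] f g.
  by move=> Df Dg x Dx; apply: continuousM; [apply: Df|apply: Dg].
move=> Df Dg; have f' := CkW Df; have g' := CkW Dg.
move: Df Dg => [df Df] [dg Dg]; split=> [x Dx|v].
  by apply: differentiableM; [apply: df|apply: dg].
(* The factor 1 gives the derivative of the product the shape required by [Ck_lin]. *)
pose h x := 1 * (f x * 'D_v g x) + g x * 'D_v f x.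
apply: (Ck_ext (f := h)) => // [x Dx|].
  rewrite [RHS](deriveM (diff_derivable (df x Dx)) (diff_derivable (dg x Dx))).
  by rewrite /h mul1r.
by apply: (Ck_lin 1 oD); apply: IHk => //; [apply: Dg|apply: Df].
Qed.

Lemma Ck_coord V n k (D : set V) (f : V -> 'rV[R]_n) j : open D ->
  Ck k D f -> Ck k D (fun x => f x ord0 j).
Proof.
move=> oD; elim: k f => [|k IHk] f.
  move=> Df x Dx; apply: (continuous_comp (f := f) (g := fun v => v ord0 j)).
    exact: Df.
  exact: coord_continuous.
move=> [df Df]; split=> [x Dx|v].
  apply: (differentiable_comp (f := f) (g := fun v => v ord0 j)); first exact: df.
  exact: differentiable_coord.
apply: (Ck_ext (f := fun x => 'D_v f x ord0 j)) => [//|x Dx|];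
  last exact: IHk (Df v).
by rewrite derive_mx ?mxE //; apply: diff_derivable; apply: df.
Qed.

(** By the chain rule a directional derivative of [flat P \o f] is [flat (flat_derive P) \o f] times
    one of [f], so the induction on [k] has to range over all [P]. *)
Lemma Ck_flat V k (D : set V) P (f : V -> R) : open D ->
  Ck k D f -> Ck k D (flat P \o f).
Proof.
move=> oD; have dflat Q s : differentiable (flat Q) s.
  by apply/derivable1_diffP; have [] := is_derive_flat Q s.
elim: k P f => [|k IHk] P f.
  move=> Df x Dx; apply: continuous_comp; first exact: Df.
  exact: differentiable_continuous.
move=> Df; have f' := CkW Df; move: Df => [df Df]; split=> [x Dx|v].
  by apply: differentiable_comp => //; apply: df.
pose h x := flat (flat_derive P) (f x) * 'D_v f x.
apply: (Ck_ext (f := h)) => // [x Dx|]; last first.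
  exact: Ck_mul (IHk _ _ f') (Df v).
have dfx := df _ Dx.
rewrite deriveE; last exact: differentiable_comp.
rewrite diff_comp // /h /= -(deriveE _ dfx).
have [_ <-] := is_derive_flat P (f x).
by rewrite deriveE // -[in RHS](mulr1 ('D_v f x)) linearZ /= mulrC.
Qed.

Lemma Ck_prod V k (D : set V) (I : Type) (r : seq I) (f : I -> V -> R) :
  open D -> (forall i, Ck k D (f i)) -> Ck k D (fun x => \prod_(i <- r) f i x).
Proof.
move=> oD fD; elim: r => [|i r IHr].
  rewrite (_ : (fun x => _) = fun=> 1); first exact: Ck_cst.
  by apply/funext => x; rewrite big_nil.
rewrite (_ : (fun x => _) = fun x => f i x * \prod_(i <- r) f i x).
  exact: Ck_mul.
by apply/funext => x; rewrite big_cons.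
Qed.

(** A product of the one-variable bumps exp(-1/(1 - t^2)), normalized at t = 0. The norm of row
    vectors is the maximum norm, so a product over the coordinates vanishes outside a ball while
    staying smooth, which the norm itself is not. *)
Definition cube_bump n (u0 : 'rV[R]_n) (d : R) (u : 'rV[R]_n) : R :=
  \prod_(j < n)
    (flat 1 (1 - ((u ord0 j - u0 ord0 j) / d) ^+ 2) / flat 1 1).

Lemma cube_bump1 n (u0 : 'rV[R]_n) d : cube_bump u0 d u0 = 1.
Proof.
rewrite /cube_bump big1 // => j _.
rewrite subrr mul0r expr0n subr0 divff // /flat ltr01 hornerE mul1r.
by rewrite expR_eq0.
Qed.

Lemma cube_bump0 n (u0 : 'rV[R]_n) d u : 0 < d -> d < `|u0 - u| ->
  cube_bump u0 d u = 0.
Proof.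
move=> d0; rewrite [X in _ < X]mx_normrE => /bigmax_gtP[|[[i j] _ /=]].
  by rewrite ltNge ltW.
rewrite !mxE ord1 => dj; rewrite /cube_bump (bigD1 j) //= flat_le0 ?mul0r //.
rewrite subr_le0 -[1](expr1n _ 2) -[leRHS]real_normK ?num_real //.
rewrite lerXn2r ?nnegrE //.
by rewrite normrM normfV (gtr0_norm d0) ler_pdivlMr // mul1r distrC ltW.
Qed.

Lemma Ck_cube_bump V n k (D : set V) (f : V -> 'rV[R]_n) u0 d : open D ->
  Ck k D f -> Ck k D (cube_bump u0 d \o f).
Proof.
move=> oD Df; apply: Ck_prod => // j.
apply: Ck_mul => //; last exact: Ck_cst.
have Dj : Ck k D (fun x => d^-1 * f x ord0 j + - (u0 ord0 j / d)).
  by apply: Ck_lin => //; [apply: Ck_coord|apply: Ck_cst].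
apply: (@Ck_flat _ _ _ 1
  (fun x => 1 - ((f x ord0 j - u0 ord0 j) / d) ^+ 2)) => //.
have := Ck_lin (-1) oD (Ck_mul oD Dj Dj) (Ck_cst k D (1 : R)).
congr (Ck _ _ _); apply/funext => x; ring.
Qed.

End CkCalculus.

(** * Bump functions on a manifold and extension by zero *)

Section Bump.
Variables (R : realType) (M : manifold R).
Implicit Types (U V : set M) (f g chi : M -> R).

Lemma smooth_onS U V f : V `<=` U -> smooth_on U f -> smooth_on V f.
Proof.
move=> VU Uf c k; apply: CkS (Uf c k) => _ [p [Vp cp] <-].
by exists p => //; split => //; apply: VU.
Qed.

Lemma smooth_onU U V f :
  smooth_on U f -> smooth_on V f -> smooth_on (U `|` V) f.
Proof.
move=> Uf Vf c k; apply: CkS (CkU (Uf c k) (Vf c k)) => _ [p [UVp cp] <-].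
by case: UVp => [Up|Vp]; [left|right]; exists p.
Qed.

Lemma eq_smooth_on U f g : open U -> (forall p, U p -> f p = g p) ->
  smooth_on U f -> smooth_on U g.
Proof.
move=> oU fg Uf c k; apply: Ck_ext (Uf c k); first exact: chart_img_openI.
by move=> _ [p [Up cp] <-] /=; rewrite chart_mapK // fg.
Qed.

Lemma smooth_on_cst U a : smooth_on U (fun=> a).
Proof. by move=> c k; apply: Ck_cst. Qed.

Lemma smooth_on_mul U f g : open U -> smooth_on U f -> smooth_on U g ->
  smooth_on U (fun p => f p * g p).
Proof.
by move=> oU Uf Ug c k; apply: Ck_mul (Uf c k) (Ug c k); apply: chart_img_openI.
Qed.

Lemma smooth_on_sum U (I : Type) (r : seq I) (P : pred I) (f : I -> M -> R) :
  open U -> (forall i, smooth_on U (f i)) ->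
  smooth_on U (fun p => \sum_(i <- r | P i) f i p).
Proof.
move=> oU fU; elim: r => [|i r IHr].
  rewrite (_ : (fun x => _) = fun=> 0); first exact: smooth_on_cst.
  by apply/funext => x; rewrite big_nil.
apply: eq_smooth_on (smooth_on_lin (P i)%:R oU (fU i) IHr) => // p _.
by rewrite big_cons; case: (P i); rewrite ?mul1r ?mul0r ?add0r.
Qed.

(** The support condition is phrased with an open [W] on which [chi] vanishes, since smoothness is
    then glued along the open cover by [U] and [W]. *)
Lemma smooth_bump U p : open U -> U p -> exists chi (W : set M),
  [/\ smooth_fun chi, chi p = 1, open W, U `|` W = setT &
      forall q, W q -> chi q = 0].
Proof.
move=> oU Up; have [c cp] := chart_cover p.
pose u0 := chart_map c p.
have : nbhs u0 (chart_map c @` (U `&` chart_dom c)).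
  by apply: open_nbhs_nbhs; split; [apply: chart_img_openI|exists p].
move=> /nbhs_closedballP[e eU].
pose d := e%:num; have d0 : 0 < d by rewrite /d.
pose B := closed_ball u0 d.
have BE u : ~ B u -> d < `|u0 - u|.
  by rewrite /B closed_ballE // /closed_ball_ /= => /negP; rewrite -ltNge.
have Bc q : chart_dom c q -> B (chart_map c q) -> U q.
  by move=> cq /eU[r [Ur cr] rq]; rewrite -(chart_mapK cq) -rq chart_mapK.
(* [K] is the image of a compact ball, hence compact, hence closed because the manifold is
   Hausdorff. Its complement is the required [W]. *)
pose K := chart_inv c @` B.
have cK : closed K.
  apply: compact_closed; first exact: manifold_hausdorff.
  apply: continuous_compact.
    apply: continuous_in_subspaceT => u; rewrite inE => /eU[q [_ cq] qu].
    by apply: chart_inv_continuous; exists q.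
  apply: bounded_closed_compact; last exact: closed_ball_closed.
  exists (d + `|u0|); split; first exact: num_real.
  move=> r dr u; rewrite /B closed_ballE // /closed_ball_ /= => u0u.
  apply: le_trans (ltW dr); rewrite -[u](subKr u0).
  by rewrite (le_trans (ler_normB _ _)) // addrC lerD2r.
pose chi q : R :=
  if `[< chart_dom c q >] then cube_bump u0 d (chart_map c q) else 0.
exists chi, (~` K); split.
(* The chart domain and the complement of [K] cover the manifold: on the first, [chi] in another
   chart is the cube bump after a transition map; on the second it is 0. *)
- have chi0 : smooth_on (~` K) chi.
    apply: eq_smooth_on (smooth_on_cst _ 0); first exact: closed_openC.
    move=> q /= Kq; rewrite /chi; case: asboolP => // cq.
    rewrite cube_bump0 //; apply: BE => Bq; apply: Kq.
    by exists (chart_map c q) => //; apply: chart_mapK.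
  have chi1 : smooth_on (chart_dom c) chi.
    move=> c' k; set D := _ @` _.
    have oD : open D by apply: chart_img_openI; apply: chart_dom_open.
    apply: (Ck_ext (f := cube_bump u0 d \o (chart_map c \o chart_inv c'))) => //.
      move=> _ [q [cq c'q] <-] /=; rewrite /chi chart_mapK //.
      by case: asboolP => // /(_ cq).
    apply: Ck_cube_bump => //; apply: CkS (@chart_transition _ M c' c k).
    by move=> _ [q [cq c'q] <-]; exists q.
  apply: smooth_onS (smooth_onU chi1 chi0) => q _.
  have [Kq|] := pselect (K q); last by right.
  left; case: Kq => u /eU[r [_ cr] <-] <-; by rewrite chart_mapK.
- by rewrite /chi; case: asboolP => // _; apply: cube_bump1.
- exact: closed_openC.
- apply/seteqP; split=> // q _.
  have [[u Bu <-]|] := pselect (K q); last by right.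
  left; have [r [Ur cr] ru] := eU _ Bu.
  by rewrite -ru chart_mapK.
- move=> q Kq; rewrite /chi; case: asboolP => // cq.
  rewrite cube_bump0 //; apply: BE => Bq; apply: Kq.
  by exists (chart_map c q) => //; apply: chart_mapK.
Qed.

(** The function is [chi * f] on [U] and 0 on [W]. The set [V] allows an [f] known to be smooth on
    an overlap only, such as an entry of a transition matrix between two frames. *)
Lemma smooth_extend U W chi f : open U -> open W -> U `|` W = setT ->
  smooth_fun chi -> (forall q, W q -> chi q = 0) -> forall V, open V ->
  smooth_on (U `&` V) f ->
  smooth_on V (fun q => if `[< U q >] then chi q * f q else 0).
Proof.
move=> oU oW UW chiM chi0 V oV fUV.
apply: (@smooth_onS ((U `&` V) `|` W)).
  move=> q Vq; have : (U `|` W) q by rewrite UW.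
  by case=> [Uq|]; [left|right].
apply: smooth_onU.
  apply: (eq_smooth_on (f := fun q => chi q * f q)); first exact: openI.
    by move=> q [Uq _]; case: asboolP.
  apply: smooth_on_mul => //; first exact: openI.
  exact: smooth_onS chiM.
apply: eq_smooth_on (smooth_on_cst _ 0) => // q /chi0 ->.
by rewrite mul0r if_same.
Qed.

End Bump.

(** * The exterior algebra *)

Section Inversions.
Variable n : nat.
Implicit Types I J K : {set 'I_n}.

Lemma inversions_sum I J :
  inversions I J = (\sum_(i in I) \sum_(j in J) (j < i))%N.
Proof.
rewrite /inversions -sum1_card pair_big /= big_mkcond [RHS]big_mkcond.
apply: eq_bigr => -[i j] _; rewrite inE /=.
by case: (i \in I); case: (j \in J); case: (j < i)%N.
Qed.

Lemma inversionsUl I J K : [disjoint I & J]%B ->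
  inversions (I :|: J) K = (inversions I K + inversions J K)%N.
Proof.
move=> IJ; rewrite !inversions_sum -bigU //.
by apply: eq_bigl => i; rewrite !inE.
Qed.

Lemma inversionsUr I J K : [disjoint J & K]%B ->
  inversions I (J :|: K) = (inversions I J + inversions I K)%N.
Proof.
move=> JK; rewrite !inversions_sum -big_split; apply: eq_bigr => i _ /=.
rewrite -bigU //.
by apply: eq_bigl => j; rewrite !inE.
Qed.

(** Elements of disjoint sets are distinct, so each pair is an inversion in exactly one of the two
    orders. *)
Lemma inversionsC I J : [disjoint I & J]%B ->
  (inversions I J + inversions J I)%N = (#|I| * #|J|)%N.
Proof.
move=> IJ; rewrite !inversions_sum [X in (_ + X)%N]exchange_big -big_split /=.
rewrite -sum_nat_const; apply: eq_bigr => i Ii.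
rewrite -big_split /= -sum1_card; apply: eq_bigr => j Jj /=.
case: ltngtP => // /val_inj ij; move/pred0P/(_ i): IJ.
by rewrite /= Ii -ij Jj.
Qed.

End Inversions.

Section ExteriorAlgebra.
Variables (R : realType) (V : vectType R).
Implicit Types (v w u : ext V) (a : R).

Lemma ext_scaleE a v I : (a *: v) I = a * v I.
Proof. by rewrite ffunE. Qed.

Lemma ext_mulDl v w u : ext_mul (v + w) u = ext_mul v u + ext_mul w u.
Proof.
apply/ffunP => K; rewrite !ffunE -big_split; apply: eq_bigr => I _ /=.
by rewrite ffunE mulrDr mulrDl.
Qed.

Lemma ext_mulDr v w u : ext_mul u (v + w) = ext_mul u v + ext_mul u w.
Proof.
apply/ffunP => K; rewrite !ffunE -big_split; apply: eq_bigr => I _ /=.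
by rewrite ffunE mulrDr.
Qed.

Lemma ext_mulZl a v u : ext_mul (a *: v) u = a *: ext_mul v u.
Proof.
apply/ffunP => K; rewrite ext_scaleE !ffunE mulr_sumr; apply: eq_bigr => I _.
by rewrite ext_scaleE (mulrCA _ a) -!mulrA.
Qed.

Lemma ext_mulZr a v u : ext_mul u (a *: v) = a *: ext_mul u v.
Proof.
apply/ffunP => K; rewrite ext_scaleE !ffunE mulr_sumr; apply: eq_bigr => I _.
by rewrite ext_scaleE mulrCA.
Qed.

Lemma ext_mul0l u : ext_mul 0 u = 0.
Proof. by rewrite -(scale0r (0 : ext V)) ext_mulZl !scale0r. Qed.

Lemma ext_mul0r u : ext_mul u 0 = 0.
Proof. by rewrite -(scale0r (0 : ext V)) ext_mulZr !scale0r. Qed.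

Lemma ext_mulNl v u : ext_mul (- v) u = - ext_mul v u.
Proof. by rewrite -scaleN1r ext_mulZl scaleN1r. Qed.

Lemma ext_mulNr v u : ext_mul u (- v) = - ext_mul u v.
Proof. by rewrite -scaleN1r ext_mulZr scaleN1r. Qed.

Lemma ext_mul_suml (I : Type) (r : seq I) (P : pred I) (F : I -> ext V) u :
  ext_mul (\sum_(i <- r | P i) F i) u = \sum_(i <- r | P i) ext_mul (F i) u.
Proof.
apply: (big_morph (fun v => ext_mul v u)) => [v w|]; first exact: ext_mulDl.
exact: ext_mul0l.
Qed.

Lemma ext_mul_sumr (I : Type) (r : seq I) (P : pred I) (F : I -> ext V) u :
  ext_mul u (\sum_(i <- r | P i) F i) = \sum_(i <- r | P i) ext_mul u (F i).
Proof.
apply: (big_morph (fun v => ext_mul u v)) => [v w|]; first exact: ext_mulDr.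
exact: ext_mul0r.
Qed.

(** At [K] both sides are sums over the splittings of [K] into three disjoint blocks, and both signs
    count the inversions between each block and every later one. *)
Lemma ext_mulA : associative (@ext_mul R V).
Proof.
move=> v w u; apply/ffunP => K; rewrite !ffunE.
under eq_bigr do rewrite ffunE mulr_sumr.
under [RHS]eq_bigr do rewrite ffunE mulr_sumr mulr_suml.
rewrite [RHS](exchange_big_dep (fun I : {set _} => I \subset K)) /=; last first.
  by move=> J I JK IJ; apply: fintype.subset_trans JK.
apply: eq_bigr => I IK.
(* On the right the union J of the first two blocks is chosen first; it is replaced by the second
   block, L = J minus I. *)
rewrite [RHS](reindex_onto (fun L : {set _} => I :|: L)
  (fun J : {set _} => J :\: I)) /=; last first.
  move=> J /andP[JK IJ]; apply/setP => i; rewrite !inE.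
  by have := fintype.subsetP IJ i; case: (i \in I) => //= ->.
have LE (L : {set _}) : (I :|: L \subset K) && (I \subset I :|: L) &&
    ((I :|: L) :\: I == L) = (L \subset K :\: I).
  rewrite finset.subUset IK finset.subsetUl andbT /= finset.subsetD.
  congr (_ && _); apply/eqP/pred0P => [LI i|LI].
    by apply/negbTE; rewrite /= -LI !inE; case: (i \in I); rewrite ?andbF.
  apply/setP => i; have := LI i; rewrite /= !inE.
  by case: (i \in I); case: (i \in L).
apply: eq_big => [L|L LK]; first by rewrite LE.
have LI : (I :|: L) :\: I = L by have := LK; rewrite -LE => /andP[_ /eqP].
have IL : [disjoint I & L]%B.
  by move: LK; rewrite finset.subsetD disjoint_sym => /andP[].
have KE : K :\: I = L :|: (K :\: (I :|: L)).
  apply/setP => i; rewrite !inE; have := fintype.subsetP LK i; rewrite !inE.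
  by case: (i \in L) => //= [->//|_]; rewrite orbF.
have dL (J : {set _}) : J \subset I :|: L -> [disjoint J & K :\: (I :|: L)]%B.
  rewrite -finset.setI_eq0 => JIL; apply/eqP/setP => i; rewrite !inE.
  by have := fintype.subsetP JIL i; rewrite !inE; case: (i \in J) => //= ->.
have -> : (K :\: I) :\: L = K :\: (I :|: L) by rewrite finset.setDDl.
rewrite LI [in inversions I (K :\: I)]KE inversionsUr ?dL ?finset.subsetUr //.
rewrite inversionsUl // !exprD.
by set s1 := _ ^+ _; set s2 := _ ^+ _; set s3 := _ ^+ _; ring.
Qed.

Lemma ext_mul1l : left_id (ext_one V) (@ext_mul R V).
Proof.
move=> v; apply/ffunP => K; rewrite ffunE (bigD1 finset.set0) ?finset.sub0set //=.
rewrite ffunE cards0 eqxx mulr1 finset.setD0 inversions_sum big_set0 mul1r.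
rewrite big1 ?addr0 // => I /andP[_ I0].
by rewrite ffunE cards_eq0 (negPf I0) mulr0 mul0r.
Qed.

Lemma ext_mul1r : right_id (ext_one V) (@ext_mul R V).
Proof.
move=> v; apply/ffunP => K; rewrite ffunE (bigD1 K) ?fintype.subxx //=.
rewrite ffunE finset.setDv cards0 eqxx mulr1 inversions_sum.
rewrite big1 ?mul1r => [|i _]; last by rewrite big_set0.
rewrite big1 ?addr0 // => I /andP[IK IneK].
rewrite ffunE cards_eq0 finset.setD_eq0 [_ \subset I](negbTE _) ?mulr0 //.
by apply: contra IneK => KI; rewrite finset.eqEsubset IK.
Qed.

Lemma ext_deg_one : ext_deg 0 (ext_one V).
Proof.
by move=> I; rewrite ffunE; have [->|_] := eqVneq #|I| 0%N; rewrite ?eqxx.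
Qed.

Lemma ext_deg_mul k l v w :
  ext_deg k v -> ext_deg l w -> ext_deg (k + l) (ext_mul v w).
Proof.
move=> vk wl K; rewrite ffunE => vwK.
have [I /andP[IK]] : exists I : {set _}, (I \subset K) &&
    ((-1) ^+ inversions I (K :\: I) * v I * w (K :\: I) != 0).
  apply/existsP; apply: contraNT vwK => /existsPn H.
  apply/eqP; rewrite big1 // => I IK; apply/eqP.
  by have := H I; rewrite IK negbK.
rewrite !mulf_eq0 !negb_or => /andP[/andP[_ /vk <-] /wl <-].
by rewrite -PoszD -(cardsID I K) (finset.setIidPr IK).
Qed.

Lemma ext_degZ k a v : ext_deg k v -> ext_deg k (a *: v).
Proof.
move=> vk I; rewrite ffunE => avI; apply: vk.
by apply: contraNN avI => /eqP ->; rewrite scaler0.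
Qed.

Lemma ext_degD k v w : ext_deg k v -> ext_deg k w -> ext_deg k (v + w).
Proof.
move=> vk wk I; rewrite ffunE; have [->|/vk //] := eqVneq (v I) 0.
by rewrite add0r => /wk.
Qed.

Lemma ext_deg0 k : ext_deg k (0 : ext V).
Proof. by move=> I; rewrite ffunE eqxx. Qed.

Lemma ext_deg_eq0 (k : int) v : k < 0 -> ext_deg k v -> v = 0.
Proof.
move=> k0 vk; apply/ffunP => I; rewrite ffunE; apply/eqP; apply: contraLR k0.
by move=> /vk <-.
Qed.

(* The reindexing I |-> K \ I turns the product into its opposite; the sign is
   given by [inversionsC]. *)
Lemma ext_mul_anticomm v w : ext_deg 1 v -> ext_deg 1 w ->
  ext_mul v w = - ext_mul w v.
Proof.
move=> v1 w1; apply/ffunP => K; rewrite !ffunE.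
rewrite (reindex_onto (fun I : {set _} => K :\: I)
  (fun I : {set _} => K :\: I)) /=; last first.
  move=> I IK; rewrite finset.setDDr finset.setDv finset.set0U.
  exact/finset.setIidPr.
rewrite -sumrN; apply: eq_big => [I|I /andP[_ /eqP KI]].
  rewrite finset.subsetDl /= finset.setDDr finset.setDv finset.set0U.
  by apply/eqP/idP => [<-|/finset.setIidPr //]; rewrite finset.subsetIl.
rewrite KI; have [->|/v1 vI] := eqVneq (v (K :\: I)) 0.
  by rewrite !mulr0 mul0r oppr0.
have [->|/w1 wI] := eqVneq (w I) 0; first by rewrite !mulr0 mul0r oppr0.
have IK : [disjoint K :\: I & I]%B.
  rewrite -finset.setI_eq0; apply/eqP/setP => i.
  by rewrite !inE; case: (i \in I); rewrite ?andbF.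
have := inversionsC IK; case: vI => ->; case: wI => -> invE.
have : (-1) ^+ inversions (K :\: I) I * (-1) ^+ inversions I (K :\: I) = -1 :> R.
  by rewrite -exprD invE.
have := sqrr_sign R (inversions (K :\: I) I).
set s := (-1) ^+ _; set s' := (-1) ^+ _ => ss ss'.
have -> : s' = - s by rewrite -[s']mul1r -ss expr2 -mulrA ss' mulrN1.
by rewrite !mulNr opprK; ring.
Qed.

Lemma ext_incl_lin a (x y : V) :
  ext_incl (a *: x + y) = a *: ext_incl x + ext_incl y.
Proof.
apply/ffunP => I; rewrite !ffunE scaler_sumr -big_split; apply: eq_bigr => i _.
by rewrite linearP.
Qed.

Lemma ext_inclD (x y : V) : ext_incl (x + y) = ext_incl x + ext_incl y.
Proof. by rewrite -[x]scale1r ext_incl_lin !scale1r. Qed.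

Lemma ext_incl0 : ext_incl 0 = 0 :> ext V.
Proof.
apply/ffunP => I; rewrite !ffunE big1 // => i _; exact: linear0.
Qed.

Lemma ext_inclZ a (x : V) : ext_incl (a *: x) = a *: ext_incl x.
Proof. by rewrite -[a *: x]addr0 ext_incl_lin ext_incl0 addr0. Qed.

Lemma ext_incl_sum (I : Type) (r : seq I) (P : pred I) (F : I -> V) :
  ext_incl (\sum_(i <- r | P i) F i) = \sum_(i <- r | P i) ext_incl (F i).
Proof. exact: (big_morph _ ext_inclD ext_incl0). Qed.

Lemma ext_deg_incl (x : V) : ext_deg 1 (ext_incl x).
Proof.
move=> I; rewrite ffunE; have [/existsP[i /eqP ->]|/existsPn H] :=
  boolP [exists i, I == finset.set1 i]; first by rewrite cards1.
by rewrite big1 ?eqxx // => i Ii; have := H i; rewrite Ii.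
Qed.

Lemma ext_incl_anticomm (x y : V) :
  ext_mul (ext_incl x) (ext_incl y) = - ext_mul (ext_incl y) (ext_incl x).
Proof. by apply: ext_mul_anticomm; apply: ext_deg_incl. Qed.

Lemma ext_incl_sqr (x : V) : ext_mul (ext_incl x) (ext_incl x) = 0.
Proof.
have /eqP := ext_incl_anticomm x x; rewrite -subr_eq0 opprK -mulr2n.
by rewrite -scaler_nat scaler_eq0 pnatr_eq0 /= => /eqP.
Qed.

End ExteriorAlgebra.

HB.instance Definition _ (R : realType) (V : vectType R) :=
  Monoid.isLaw.Build (ext V) (ext_one V) (@ext_mul R V)
    (@ext_mulA R V) (@ext_mul1l R V) (@ext_mul1r R V).

(** * Products of monomials, with constants independent of the vector space *)

Section Monomials.
Variables (R : realType) (n : nat).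
Implicit Types (I J : {set 'I_n}) (s : seq 'I_n).

(** Words may be unsorted and have repeated letters, as happens when two monomials are
    multiplied. *)
Definition ext_word (V : vectType R) (u : n.-tuple V) s : ext V :=
  \big[@ext_mul R V/ext_one V]_(i <- s) ext_incl (tnth u i).

Lemma ext_monomialE (V : vectType R) (u : n.-tuple V) I :
  ext_monomial u I = ext_word u (enum I).
Proof.
rewrite /ext_word -big_filter /ext_monomial -[LHS]big_filter.
by rewrite [index_enum _]unlock filter_predT.
Qed.

Lemma ext_monomial0 (V : vectType R) (u : n.-tuple V) :
  ext_monomial u finset.set0 = ext_one V.
Proof. by rewrite /ext_monomial big_set0. Qed.

Lemma ext_monomial1 (V : vectType R) (u : n.-tuple V) i :
  ext_monomial u (finset.set1 i) = ext_incl (tnth u i).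
Proof. by rewrite /ext_monomial big_set1. Qed.

Lemma ext_deg_word (V : vectType R) (u : n.-tuple V) s :
  ext_deg (size s)%:Z (ext_word u s).
Proof.
elim: s => [|i s IHs]; rewrite /ext_word ?big_nil ?big_cons.
  exact: ext_deg_one.
by rewrite /= intS; apply: ext_deg_mul IHs; apply: ext_deg_incl.
Qed.

Lemma ext_deg_monomial (V : vectType R) (u : n.-tuple V) I :
  ext_deg #|I|%:Z (ext_monomial u I).
Proof. by rewrite ext_monomialE cardE; apply: ext_deg_word. Qed.

Let lt_ord := relpre (@nat_of_ord n) ltn.

Let lt_ord_trans : transitive lt_ord.
Proof. by move=> i j k; apply: ltn_trans. Qed.

Let sorted_enumE s : sorted lt_ord s -> s = enum [set i in s].
Proof.
move=> ss; apply: (irr_sorted_eq lt_ord_trans) => // [i||i].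
- by rewrite /lt_ord /= ltnn.
- rewrite /enum_mem; apply: sorted_filter => //.
  by rewrite /lt_ord -sorted_map -enumT val_enum_ord iota_ltn_sorted.
- by rewrite mem_enum inE.
Qed.

(** One step of insertion sort: the new letter moves right past the smaller ones, with a sign each
    time, and the word is 0 if the letter already occurs. The inclusion of letters ensures, in the
    induction, that the head stays smaller than the rest. *)
Let ext_word_insert i s : sorted lt_ord s ->
  exists c : R, exists s', [/\ sorted lt_ord s', {subset s' <= i :: s} &
    forall (V : vectType R) (u : n.-tuple V),
      ext_mul (ext_incl (tnth u i)) (ext_word u s) = c *: ext_word u s'].
Proof.
elim: s => [|j s IHs] /=.
  exists 1, [:: i]; split=> // V u.
  by rewrite scale1r /ext_word big_cons.
move=> ss; case: (ltngtP i j) => ij.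
- exists 1, [:: i, j & s]; split=> [|//|V u].
    exact/andP.
  by rewrite scale1r /ext_word [RHS]big_cons.
- have [c [s' [ss' s'i s'E]]] := IHs (path_sorted ss).
  exists (- c), (j :: s'); split=> [|k|V u].
  + rewrite /= path_min_sorted //; apply/allP => k /s'i.
    rewrite inE => /predU1P[-> //|ks].
    by have /allP/(_ _ ks) := order_path_min lt_ord_trans ss.
  + rewrite inE => /predU1P[->|/s'i]; first by rewrite !inE eqxx orbT.
    by rewrite !inE => /orP[->|->]; rewrite ?orbT.
  + rewrite /ext_word !big_cons -!/(ext_word _ _) ext_mulA ext_incl_anticomm.
    by rewrite -scaleN1r ext_mulZl -ext_mulA s'E ext_mulZr scalerA mulN1r.
- exists 0, [::]; split=> // V u.
  rewrite scale0r /ext_word big_cons ext_mulA (val_inj ij) ext_incl_sqr.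
  exact: ext_mul0l.
Qed.

(** The order of the quantifiers is the point: [c] and [I] serve for all fibres at once. *)
Lemma ext_word_monomial s : exists c : R, exists I,
  forall (V : vectType R) (u : n.-tuple V),
    ext_word u s = c *: ext_monomial u I.
Proof.
have [c [s' [/sorted_enumE-> s'E]]] : exists c : R, exists s',
    sorted lt_ord s' /\ forall (V : vectType R) (u : n.-tuple V),
    ext_word u s = c *: ext_word u s'.
  elim: s => [|i s [c [s' [ss' s'E]]]].
    by exists 1, [::]; split=> // V u; rewrite scale1r.
  have [d [t [st _ tE]]] := ext_word_insert i ss'.
  exists (c * d), t; split=> // V u.
  by rewrite {1}/ext_word big_cons -/(ext_word _ _) s'E ext_mulZr tE scalerA.
by exists c, [set i in s'] => V u; rewrite s'E ext_monomialE.
Qed.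

Lemma ext_monomial_mul I J : exists c : R, exists K,
  forall (V : vectType R) (u : n.-tuple V),
    ext_mul (ext_monomial u I) (ext_monomial u J) = c *: ext_monomial u K.
Proof.
have [c [K KE]] := ext_word_monomial (enum I ++ enum J).
by exists c, K => V u; rewrite -KE !ext_monomialE [RHS]big_cat.
Qed.

End Monomials.

(** * Multivectors *)

Section MultivectorClosure.
Variables (R : realType) (M : manifold R) (A : vector_bundle M).
Implicit Types (x y z : mvfield A) (k l : int) (f : M -> R) (u : section A).

(** In a frame the coefficients of the wedge product are combinations, with constant weights, of
    products of the coefficients of the factors. *)
Lemma multivector_wedge x y :
  multivector x -> multivector y -> multivector (wedge x y).
Proof.
move=> xA yA t; have [[f fU xE] [g gU yE]] := (xA t, yA t).
have oU := triv_dom_open t.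
(* The constant and the index set are chosen once for all points, so they can enter the smooth
   coefficients. *)
have /choice[cL cLE] : forall IJ : {set 'I_(rank A)} * {set 'I_(rank A)},
    exists cL : R * {set 'I_(rank A)},
    forall (V : vectType R) (u : (rank A).-tuple V),
      ext_mul (ext_monomial u IJ.1) (ext_monomial u IJ.2) =
      cL.1 *: ext_monomial u cL.2.
  move=> [I J]; have [c [L cLE]] := ext_monomial_mul R I J.
  by exists (c, L).
exists (fun L p => \sum_I \sum_J
    (if (cL (I, J)).2 == L then (cL (I, J)).1 else 0) * (f I p * g J p)).
  move=> L; apply: smooth_on_sum => // I; apply: smooth_on_sum => // J.
  apply: smooth_on_mul => //; first exact: smooth_on_cst.
  exact: smooth_on_mul.
move=> p tp; rewrite /wedge xE // yE // ext_mul_suml.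
under [RHS]eq_bigr do rewrite scaler_suml.
rewrite [RHS]exchange_big; apply: eq_bigr => I _ /=.
rewrite ext_mul_sumr.
under [RHS]eq_bigr do rewrite scaler_suml.
rewrite [RHS]exchange_big; apply: eq_bigr => J _ /=.
rewrite ext_mulZl ext_mulZr (cLE (I, J)) /= [RHS](bigD1 (cL (I, J)).2) //= eqxx.
rewrite [X in _ = _ + X]big1 ?addr0 => [|L]; last first.
  by rewrite eq_sym => /negPf->; rewrite mul0r scale0r.
by rewrite !scalerA mulrC.
Qed.

Lemma multivector_fun f : smooth_fun f -> multivector (mv_fun A f).
Proof.
move=> fM t.
exists (fun I p => if I == finset.set0 then f p else 0) => [I|p tp].
  by case: eqP => _; [apply: smooth_onS fM|apply: smooth_on_cst].
rewrite (bigD1 finset.set0) //= eqxx ext_monomial0 big1 ?addr0 // => I.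
by move=> /negPf ->; rewrite scale0r.
Qed.

Lemma multivector_section u : smooth_section u -> multivector (mv_section u).
Proof.
move=> uA t; have [g gU uE] := uA t.
exists (fun I p => \sum_i (if I == finset.set1 i then 1 else 0) * g i p)
    => [I|p tp].
  apply: smooth_on_sum => // [|i]; first exact: triv_dom_open.
  apply: smooth_on_mul => //; first exact: triv_dom_open.
  exact: smooth_on_cst.
under eq_bigr do rewrite scaler_suml.
rewrite exchange_big /mv_section uE // ext_incl_sum; apply: eq_bigr => i _ /=.
rewrite (bigD1 (finset.set1 i)) //= eqxx mul1r ext_monomial1 ext_inclZ.
by rewrite big1 ?addr0 // => I /negPf->; rewrite mul0r scale0r.
Qed.

Lemma multivector0 : multivector (fun=> 0 : ext (A _)).
Proof.
rewrite (_ : (fun p => _) = mv_fun A (fun=> 0)).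
  exact/multivector_fun/smooth_on_cst.
by apply/functional_extensionality_dep => p; rewrite /mv_fun scale0r.
Qed.

Lemma multivectorZ (a : R) x : multivector x -> multivector (fun p => a *: x p).
Proof.
move=> xA; rewrite (_ : (fun p => _) = fun p => a *: x p + 0).
  exact: multivector_lin multivector0.
by apply/functional_extensionality_dep => p; rewrite addr0.
Qed.

Lemma multivectorD x y :
  multivector x -> multivector y -> multivector (fun p => x p + y p).
Proof.
move=> xA yA; rewrite (_ : (fun p => _) = fun p => 1 *: x p + y p).
  exact: multivector_lin.
by apply/functional_extensionality_dep => p; rewrite scale1r.
Qed.

Lemma multivector_sum (I : Type) (r : seq I) (P : pred I) (F : I -> mvfield A) :
  (forall i, P i -> multivector (F i)) ->
  multivector (fun p => \sum_(i <- r | P i) F i p).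
Proof.
move=> FA; elim: r => [|i r IHr].
  rewrite (_ : (fun p => _) = fun=> 0); first exact: multivector0.
  by apply/functional_extensionality_dep => p; rewrite big_nil.
rewrite (_ : (fun p => _) = fun p => (if P i then F i p else 0) +
    \sum_(i <- r | P i) F i p).
  apply: multivectorD => //; case Pi : (P i); [exact: FA|exact: multivector0].
apply/functional_extensionality_dep => p.
by rewrite big_cons; case: ifP; rewrite ?add0r.
Qed.

Lemma ext_comp_deg (V : vectType R) (k l : nat) (v : ext V) :
  ext_deg l%:Z v -> ext_comp k v = if l == k then v else 0.
Proof.
move=> vl; apply/ffunP => I.
rewrite ffunE (fun_if (fun w : ext V => w I)) [in RHS]ffunE.
have [->|vI] := eqVneq (v I) 0; first by rewrite !if_same.
by have /eqP := vl _ vI; rewrite eqz_nat => /eqP ->.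
Qed.

Lemma ext_compD (V : vectType R) (k : nat) (v w : ext V) :
  ext_comp k (v + w) = ext_comp k v + ext_comp k w.
Proof. by apply/ffunP => I; rewrite !ffunE; case: ifP; rewrite ?addr0. Qed.

Lemma ext_compZ (V : vectType R) (k : nat) a (v : ext V) :
  ext_comp k (a *: v) = a *: ext_comp k v.
Proof. by apply/ffunP => I; rewrite !ffunE; case: ifP; rewrite ?scaler0. Qed.

Lemma ext_comp_sum (V : vectType R) (k : nat) (I : Type) (r : seq I)
    (F : I -> ext V) :
  ext_comp k (\sum_(i <- r) F i) = \sum_(i <- r) ext_comp k (F i).
Proof.
apply: (big_morph _ (ext_compD k)).
by apply/ffunP => J; rewrite !ffunE if_same.
Qed.

Lemma ext_deg_comp (V : vectType R) (k : nat) (v : ext V) :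
  ext_deg k%:Z (ext_comp k v).
Proof.
by move=> I; rewrite ffunE; have [->|_] := eqVneq #|I| k; rewrite ?eqxx.
Qed.

(** [ext_comp] selects by the size of index sets for the fibre basis, but a frame monomial is
    homogeneous there too, so the selection acts on the frame coefficients. *)
Lemma multivector_comp (k : nat) x : multivector x -> multivector (mv_comp k x).
Proof.
move=> xA t; have [g gU xE] := xA t.
exists (fun (I : {set _}) p => if #|I| == k then g I p else 0) => [I|p tp].
  by case: eqP => _ //; apply: smooth_on_cst.
rewrite /mv_comp xE // ext_comp_sum; apply: eq_bigr => I _.
rewrite ext_compZ (ext_comp_deg k (@ext_deg_monomial _ _ _ (frame t p) I)).
by case: ifP; rewrite ?scale0r ?scaler0.
Qed.

Lemma mv_deg_comp (k : nat) x :
  multivector x -> multivector_deg k (mv_comp k x).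
Proof.
by move=> xA; split; [apply: multivector_comp|move=> p; apply: ext_deg_comp].
Qed.

Lemma mv_deg_wedge k l x y : multivector_deg k x -> multivector_deg l y ->
  multivector_deg (k + l) (wedge x y).
Proof.
move=> [xA xk] [yA yl]; split; first exact: multivector_wedge.
by move=> p; apply: ext_deg_mul.
Qed.

Lemma mv_deg_fun f : smooth_fun f -> multivector_deg 0 (mv_fun A f).
Proof.
move=> fM; split; first exact: multivector_fun.
by move=> p; apply/ext_degZ/ext_deg_one.
Qed.

Lemma mv_deg_section u : smooth_section u -> multivector_deg 1 (mv_section u).
Proof.
move=> uA; split; first exact: multivector_section.
by move=> p; apply: ext_deg_incl.
Qed.

Lemma mv_deg_lin k (a : R) x y : multivector_deg k x -> multivector_deg k y ->
  multivector_deg k (fun p => a *: x p + y p).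
Proof.
move=> [xA xk] [yA yk]; split; first exact: multivector_lin.
by move=> p; apply: ext_degD => //; apply: ext_degZ.
Qed.

Lemma mv_deg_lt0 k x : k < 0 -> multivector_deg k x -> x = fun=> 0.
Proof.
move=> k0 [_ xk]; apply/functional_extensionality_dep => p.
exact: ext_deg_eq0 (xk p).
Qed.

Lemma wedge_fun f x : wedge (mv_fun A f) x = fun p => f p *: x p.
Proof.
apply/functional_extensionality_dep => p.
by rewrite /wedge /mv_fun ext_mulZl ext_mul1l.
Qed.

Lemma mv_comp_sum x p : x p = \sum_(k < (rank A).+1) mv_comp k x p.
Proof.
apply/ffunP => I; rewrite sum_ffunE.
have [t tp] := triv_cover A p.
have dimE : \dim (fullv : {vspace A p}) = rank A.
  by rewrite -(size_basis (frame_basis tp)).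
have Ile : (#|I| < (rank A).+1)%N.
  by rewrite ltnS -dimE -[leqRHS]card_ord max_card.
rewrite (bigD1 (Ordinal Ile)) //= ffunE eqxx big1 ?addr0 // => k kI.
by rewrite ffunE; case: eqP => // Ik; case/eqP: kI; apply: val_inj.
Qed.

End MultivectorClosure.

(** * Graded derivations *)

Section Signs.
Variable R : realType.
Implicit Types m n : int.

Lemma signzD m n : (-1) ^ (m + n) = (-1) ^ m * (-1) ^ n :> R.
Proof. by apply: expfzDr; rewrite oppr_eq0 oner_eq0. Qed.

Lemma signz_sqr m : (-1) ^ m * (-1) ^ m = 1 :> R.
Proof. by rewrite -expfzMl mulrNN mulr1 exp1rz. Qed.

End Signs.

Section Derivations.
Variables (R : realType) (M : manifold R) (A : vector_bundle M).
Implicit Types (x y z : mvfield A) (d k l : int) (D : mvfield A -> mvfield A).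

(** The laws are equations between fields, not pointwise ones, so that they can be rewritten inside
    the argument of another operator. *)
Record graded_derivation d D : Prop := GradedDerivation {
  gd_lin : forall a x y, multivector x -> multivector y ->
    D (fun p => a *: x p + y p) = fun p => a *: D x p + D y p;
  gd_degree : forall k x, multivector_deg k x -> multivector_deg (k + d) (D x);
  gd_leibniz : forall k l x y, multivector_deg k x -> multivector_deg l y ->
    D (wedge x y) =
    fun p => wedge (D x) y p + (-1) ^ (d * k) *: wedge x (D y) p
}.

Section Theory.
Variables (d : int) (D : mvfield A -> mvfield A).
Hypothesis DD : graded_derivation d D.

Lemma gd0 : D (fun=> 0) = fun=> 0.
Proof.
have := gd_lin DD (-1) (@multivector0 R M A) (@multivector0 R M A).
rewrite (_ : (fun p => _ *: _ + _) = fun=> 0); last first.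
  by apply/functional_extensionality_dep => p; rewrite scaler0 addr0.
by move=> ->; apply/functional_extensionality_dep => p; rewrite scaleN1r addNr.
Qed.

Lemma gdZ a x : multivector x -> D (fun p => a *: x p) = fun p => a *: D x p.
Proof.
move=> xA; have := gd_lin DD a xA (@multivector0 R M A); rewrite gd0.
rewrite (_ : (fun p => _ *: _ + 0) = fun p => a *: x p); last first.
  by apply/functional_extensionality_dep => p; rewrite addr0.
by move=> ->; apply/functional_extensionality_dep => p; rewrite addr0.
Qed.

Lemma gdDZ a x y : multivector x -> multivector y ->
  D (fun p => x p + a *: y p) = fun p => D x p + a *: D y p.
Proof.
move=> xA yA; rewrite (_ : (fun p => _ + _) = fun p => a *: y p + x p).
  rewrite (gd_lin DD) //.
  by apply/functional_extensionality_dep => p; rewrite addrC.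
by apply/functional_extensionality_dep => p; rewrite addrC.
Qed.

Lemma gd_sum (I : Type) (r : seq I) (F : I -> mvfield A) :
  (forall i, multivector (F i)) ->
  D (fun p => \sum_(i <- r) F i p) = fun p => \sum_(i <- r) D (F i) p.
Proof.
move=> FA; elim: r => [|i r IHr].
  rewrite (_ : (fun p => _) = fun=> 0); last first.
    by apply/functional_extensionality_dep => p; rewrite big_nil.
  by rewrite gd0; apply/functional_extensionality_dep => p; rewrite big_nil.
rewrite (_ : (fun p => _) = fun p => 1 *: F i p + \sum_(i <- r) F i p); last first.
  by apply/functional_extensionality_dep => p; rewrite big_cons scale1r.
rewrite (gd_lin DD) ?IHr //; last exact: multivector_sum.
by apply/functional_extensionality_dep => p; rewrite big_cons scale1r.
Qed.

Lemma gd_multivector x : multivector x -> multivector (D x).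
Proof.
move=> xA.
rewrite (_ : x = fun p => \sum_(k < (rank A).+1) mv_comp k x p); last first.
  by apply/functional_extensionality_dep => p; apply: mv_comp_sum.
rewrite gd_sum => [|k]; last exact: multivector_comp.
apply: multivector_sum => k _.
by have [] := gd_degree DD (mv_deg_comp k xA).
Qed.

End Theory.

Definition section_word (n : nat) (u : 'I_n -> section A) (s : seq 'I_n) :
  mvfield A :=
  fun p => \big[@ext_mul R (A p)/ext_one (A p)]_(i <- s) ext_incl (u i p).

Lemma section_word_cons n (u : 'I_n -> section A) i s :
  section_word u (i :: s) = wedge (mv_section (u i)) (section_word u s).
Proof.
by apply/functional_extensionality_dep => p; rewrite /section_word big_cons.
Qed.

Lemma section_word_nil n (u : 'I_n -> section A) :
  section_word u [::] = mv_fun A (fun=> 1).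
Proof.
apply/functional_extensionality_dep => p.
by rewrite /section_word big_nil /mv_fun scale1r.
Qed.

Lemma mv_deg_section_word n (u : 'I_n -> section A) s :
  (forall i, smooth_section (u i)) ->
  multivector_deg (size s)%:Z (section_word u s).
Proof.
move=> uA; elim: s => [|i s IHs].
  by rewrite section_word_nil; apply: mv_deg_fun; apply: smooth_on_cst.
rewrite section_word_cons /= intS; apply: mv_deg_wedge => //.
exact: mv_deg_section.
Qed.

(** In another frame [s] the coordinates are [chi] times a column of the transition matrix, smooth
    on the overlap only, and [smooth_extend] carries them to all of [triv_dom s]. *)
Lemma smooth_section_cutoff (t : triv_index A) (chi : M -> R) (W : set M) j :
  smooth_fun chi -> open W -> triv_dom t `|` W = setT ->
  (forall q, W q -> chi q = 0) ->
  smooth_section (fun q =>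
    if `[< triv_dom t q >] then chi q *: tnth (frame t q) j else 0).
Proof.
move=> chiM oW UW chi0 s; have [g gU gE] := frame_transition s t.
exists (fun i q => if `[< triv_dom t q >] then chi q * g i j q else 0) => [i|p sp].
  apply: (smooth_extend _ oW UW) => //; try exact: triv_dom_open.
  by rewrite setIC.
case: asboolP => tp; last by rewrite big1 // => i _; rewrite scale0r.
by rewrite (gE p) // scaler_sumr; apply: eq_bigr => i _; rewrite scalerA.
Qed.

(* Multiplying by a power of a bump function at p turns the expansion of x in a
   local frame into a global sum of products of functions and sections. *)
Lemma multivector_decomp x p : multivector x ->
  exists (chi : M -> R) (g : {set 'I_(rank A)} -> M -> R)
         (u : 'I_(rank A) -> section A),
    [/\ smooth_fun chi /\ chi p = 1, forall I, smooth_fun (g I),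
        forall i, smooth_section (u i) &
        forall q, chi q *: x q =
          \sum_I wedge (mv_fun A (g I)) (section_word u (enum I)) q].
Proof.
move=> xA; have [t tp] := triv_cover A p; have oU := triv_dom_open t.
have [chi [W [chiM chip oW UW chi0]]] := smooth_bump oU tp.
have [g gU xE] := xA t; set U := triv_dom t in oU UW gU xE.
have chiX n : smooth_fun (fun q => chi q ^+ n).
  elim: n => [|n IHn].
    rewrite (_ : (fun q => _) = fun=> 1); first exact: smooth_on_cst.
    by apply/funext => q; rewrite expr0.
  rewrite (_ : (fun q => _) = fun q => chi q * chi q ^+ n).
    by apply: smooth_on_mul => //; apply: openT.
  by apply/funext => q; rewrite exprS.
pose u j q := if `[< U q >] then chi q *: tnth (frame t q) j else 0.
(* Each of the |I| sections in a word absorbs one factor [chi]; at least one factor then remains for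
   the coefficient, which needs it to extend smoothly by 0. *)
exists (fun q => chi q ^+ (rank A).+1),
  (fun (I : {set _}) q =>
    if `[< U q >] then chi q ^+ (rank A - #|I|).+1 * g I q else 0), u.
split=> [|I|i|q].
- by split=> //; rewrite chip expr1n.
- apply: (smooth_extend _ oW UW) => //; last 1 first.
  + by apply: smooth_onS (gU I) => q [].
  + by move=> q /chi0 ->; rewrite expr0n.
  + exact: openT.
- exact: smooth_section_cutoff chiM oW UW chi0.
have [Uq|Uq] := pselect (U q); last first.
  have : (U `|` W) q by rewrite UW.
  case=> // /chi0 ->; rewrite expr0n scale0r big1 // => I _.
  by rewrite wedge_fun; case: asboolP => // _; rewrite scale0r.
have wordE s : section_word u s q = chi q ^+ size s *: ext_word (frame t q) s.
  elim: s => [|i s IHs]; rewrite /section_word /ext_word ?big_nil ?big_cons.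
    by rewrite scale1r.
  rewrite -/(section_word u s q) IHs /u; case: asboolP => // _.
  by rewrite ext_inclZ ext_mulZl ext_mulZr scalerA exprS.
rewrite xE // scaler_sumr; apply: eq_bigr => I _.
rewrite wedge_fun wordE -ext_monomialE -cardE; case: asboolP => // _.
rewrite !scalerA; congr (_ *: _).
have IA : (#|I| <= rank A)%N by rewrite -[leqRHS]card_ord max_card.
by rewrite mulrAC -exprD addSn subnK.
Qed.

(* D (chi * x) = chi * D x since D chi = 0. *)
Lemma derivation_eq0 d D k x : graded_derivation d D ->
  (forall f, smooth_fun f -> D (mv_fun A f) = fun=> 0) ->
  (forall u, smooth_section u -> D (mv_section u) = fun=> 0) ->
  multivector_deg k x -> D x = fun=> 0.
Proof.
move=> DD Df Du xk; apply/functional_extensionality_dep => p.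
have [xA _] := xk.
have [chi [g [u [[chiM chip] gM uA xE]]]] := multivector_decomp p xA.
have Dw s : D (section_word u s) = fun=> 0.
  elim: s => [|i s IHs].
    by rewrite section_word_nil Df //; apply: smooth_on_cst.
  have uis := mv_deg_section_word s uA.
  rewrite section_word_cons (gd_leibniz DD (mv_deg_section (uA i)) uis).
  apply/functional_extensionality_dep => q.
  by rewrite Du // IHs /wedge ext_mul0l ext_mul0r scaler0 addr0.
have : D (wedge (mv_fun A chi) x) p = D x p.
  rewrite (gd_leibniz DD (mv_deg_fun A chiM) xk) Df // wedge_fun.
  by rewrite /wedge ext_mul0l mulr0 expr0z scale1r add0r chip scale1r.
move=> <-; rewrite wedge_fun.
rewrite (_ : (fun q => _) =
    fun q => \sum_I wedge (mv_fun A (g I)) (section_word u (enum I)) q); last first.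
  by apply/functional_extensionality_dep.
have gw (I : {set _}) := mv_deg_section_word (enum I) uA.
rewrite (gd_sum DD) => [|I]; last first.
  by have [] := mv_deg_wedge (mv_deg_fun A (gM I)) (gw I).
rewrite big1 // => I _.
rewrite (gd_leibniz DD (mv_deg_fun A (gM I)) (gw I)) Df // Dw.
by rewrite /wedge ext_mul0l ext_mul0r scaler0 addr0.
Qed.

Lemma eq_derivation d D D' k x :
  graded_derivation d D -> graded_derivation d D' ->
  (forall f, smooth_fun f -> D (mv_fun A f) = D' (mv_fun A f)) ->
  (forall u, smooth_section u -> D (mv_section u) = D' (mv_section u)) ->
  multivector_deg k x -> D x = D' x.
Proof.
move=> DD DD' Df Du xk; apply/functional_extensionality_dep => p.
apply/eqP; rewrite -subr_eq0; apply/eqP.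
pose E y : mvfield A := fun p => D y p - D' y p.
suff : E x = fun=> 0 by move/(congr1 (fun y : mvfield A => y p)).
apply: (@derivation_eq0 d E k) => //; last 2 first.
- move=> f /Df fE; apply/functional_extensionality_dep => q.
  by rewrite /E fE subrr.
- move=> u /Du uE; apply/functional_extensionality_dep => q.
  by rewrite /E uE subrr.
split=> [a y z yA zA|l y yl|l m y z yl zm].
- apply/functional_extensionality_dep => q.
  rewrite /E (gd_lin DD) // (gd_lin DD') //.
  by rewrite opprD addrACA -scalerBr.
- rewrite (_ : E y = fun q => -1 *: D' y q + D y q).
    by apply: mv_deg_lin; [apply: (gd_degree DD')|apply: (gd_degree DD)].
  by apply/functional_extensionality_dep => q; rewrite scaleN1r addrC.
- apply/functional_extensionality_dep => q.
  rewrite /E (gd_leibniz DD yl zm) (gd_leibniz DD' yl zm) opprD addrACA.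
  rewrite -scalerBr /wedge.
  by rewrite ext_mulDl ext_mulDr ext_mulNl ext_mulNr.
Qed.

(** In the Leibniz rule the mixed terms, with [D] on one factor and [E] on the other, occur twice
    with opposite signs. Applied to the brackets with x and with y, this makes the Jacobiator a
    derivation. *)
Lemma derivation_commutator d e D E :
  graded_derivation d D -> graded_derivation e E ->
  graded_derivation (d + e)
    (fun x p => D (E x) p - (-1) ^ (d * e) *: E (D x) p).
Proof.
move=> DD EE; split=> [a x y xA yA|k x xk|k l x y xk yl].
- apply/functional_extensionality_dep => p.
  have [Dx Dy] := (gd_multivector DD xA, gd_multivector DD yA).
  have [Ex Ey] := (gd_multivector EE xA, gd_multivector EE yA).
  rewrite (gd_lin EE a xA yA) (gd_lin DD a xA yA) (gd_lin DD a Ex Ey).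
  rewrite (gd_lin EE a Dx Dy).
  by rewrite scalerDr opprD addrACA scalerBr !scalerA mulrC.
- have DEx := gd_degree DD (gd_degree EE xk).
  have EDx := gd_degree EE (gd_degree DD xk).
  rewrite (_ : (fun p => _) =
    fun p => - (-1) ^ (d * e) *: E (D x) p + D (E x) p); last first.
    by apply/functional_extensionality_dep => p; rewrite scaleNr addrC.
  rewrite -addrA (addrC e) addrA in DEx.
  by rewrite addrA; apply: mv_deg_lin.
have [xA _] := xk; have [yA _] := yl.
have [Dx Ex] := (gd_degree DD xk, gd_degree EE xk).
have [Dy Ey] := (gd_degree DD yl, gd_degree EE yl).
have mv m n v w : multivector_deg m v -> multivector_deg n w ->
  multivector (wedge v w) by move=> vm wn; have [] := mv_deg_wedge vm wn.
apply/functional_extensionality_dep => p.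
rewrite (gd_leibniz EE xk yl) (gd_leibniz DD xk yl).
rewrite (gdDZ DD) ?(gdDZ EE); try by apply: mv; eassumption.
rewrite (gd_leibniz DD Ex yl) (gd_leibniz DD xk Ey).
rewrite (gd_leibniz EE Dx yl) (gd_leibniz EE xk Dy).
rewrite /wedge !(ext_mulDl, ext_mulDr, ext_mulNl, ext_mulNr, ext_mulZl, ext_mulZr).
rewrite !mulrDr !mulrDl !signzD [e * d]mulrC.
have := signz_sqr R (d * e).
move: ((-1) ^ (d * e) : R) ((-1) ^ (d * k) : R) ((-1) ^ (e * k) : R) => s a b ss.
move: (ext_mul (D (E x) p) _) (ext_mul (E x p) _) (ext_mul (D x p) _)
  (ext_mul _ (D (E y) p)) (ext_mul (E (D x) p) _) (ext_mul _ (E (D y) p)).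
(* Coefficientwise this is a polynomial identity in the signs, modulo s^2 = 1. *)
move=> v1 v2 v3 v4 v5 v6; apply/ffunP => I.
do ?[rewrite ext_scaleE || rewrite ffunE].
by ring: ss.
Qed.

End Derivations.

(** * The Schouten bracket *)

Section AnchorBracket.
Variables (R : realType) (M : manifold R) (A : vector_bundle M).
Variable L : lie_algebroid A.
Implicit Types (u v w : section A) (f : M -> R).

Lemma smooth_section_scale f u : smooth_fun f -> smooth_section u ->
  smooth_section (fun p => f p *: u p).
Proof.
move=> fM uA t; have [g gU uE] := uA t.
exists (fun i p => f p * g i p) => [i|p tp].
  apply: smooth_on_mul => //; first exact: triv_dom_open.
  exact: smooth_onS fM.
by rewrite uE // scaler_sumr; apply: eq_bigr => i _; rewrite scalerA.
Qed.

Lemma smooth_section0 : smooth_section (fun=> 0 : A _).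
Proof.
move=> t; exists (fun _ _ => 0) => [i|p _]; first exact: smooth_on_cst.
by rewrite big1 // => i _; rewrite scale0r.
Qed.

Lemma anchor_act0 f u p : smooth_fun f -> u p = 0 ->
  anchor_act (laanchor L) u f p = 0.
Proof.
move=> fM up; rewrite /anchor_act up.
have := anchor_linear (laanchor L) (p := p) (-1) 0 0 fM.
by rewrite scaler0 addr0 mulN1r addNr.
Qed.

Lemma labracket_leibniz_jacobi u v w :
  smooth_section u -> smooth_section v -> smooth_section w -> forall p,
  labracket L (labracket L u v) w p =
  labracket L u (labracket L v w) p - labracket L v (labracket L u w) p.
Proof.
move=> uA vA wA p; have := labracket_jacobi L uA vA wA p.
have [uvA uwA] := (labracket_smooth L uA vA, labracket_smooth L uA wA).
rewrite [labracket L w (labracket L u v) p](labracket_skew L) //.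
rewrite (_ : labracket L w u = fun q => -1 *: labracket L u w q + 0); last first.
  apply/functional_extensionality_dep => q.
  by rewrite labracket_skew // scaleN1r addr0.
rewrite (labracket_bilinear L (-1) uwA smooth_section0 vA).2.
have := (labracket_bilinear L (-1) smooth_section0 smooth_section0 vA).2 p.
rewrite (_ : (fun q => _ *: _ + _) = fun=> 0); last first.
  by apply/functional_extensionality_dep => q; rewrite scaler0 addr0.
rewrite scaleN1r addNr => ->; rewrite addr0 scaleN1r => /eqP.
by rewrite subr_eq0 => /eqP.
Qed.

(* By the Leibniz rule and the Jacobi identity for u, v and f w, the two sides
   have the same product with w p, for every section w. *)
Lemma anchor_bracket u v f p :
  smooth_section u -> smooth_section v -> smooth_fun f ->
  anchor_act (laanchor L) (labracket L u v) f p =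
  anchor_act (laanchor L) u (anchor_act (laanchor L) v f) p -
  anchor_act (laanchor L) v (anchor_act (laanchor L) u f) p.
Proof.
move=> uA vA fM.
have auf : smooth_fun (anchor_act (laanchor L) u f) by apply: anchor_smooth.
have avf : smooth_fun (anchor_act (laanchor L) v f) by apply: anchor_smooth.
have uvA := labracket_smooth L uA vA.
(* If every smooth section vanishes at [p] there is no [w] to cancel, but then both sides are 0
   because the anchor is linear on the fibre. *)
have [[w [wA wp]]|w0] := pselect (exists w, smooth_section w /\ w p <> 0);
    last first.
  have s0 w : smooth_section w -> w p = 0.
    move=> wA; apply: contrapT => wp; apply: w0.
    by exists w.
  by rewrite !anchor_act0 ?subr0 //; apply: s0.
have fwA := smooth_section_scale fM wA.
have E s t (sA : smooth_section s) (tA : smooth_section t) :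
    smooth_fun (anchor_act (laanchor L) t f) ->
    labracket L s (labracket L t (fun q => f q *: w q)) p =
    f p *: labracket L s (labracket L t w) p +
    anchor_act (laanchor L) s f p *: labracket L t w p +
    (anchor_act (laanchor L) t f p *: labracket L s w p +
     anchor_act (laanchor L) s (anchor_act (laanchor L) t f) p *: w p).
  move=> atf; have twA := labracket_smooth L tA wA.
  rewrite (_ : labracket L t (fun q => f q *: w q) = fun q =>
      1 *: (f q *: labracket L t w q) +
      anchor_act (laanchor L) t f q *: w q); last first.
    apply/functional_extensionality_dep => q.
    by rewrite labracket_leibniz // scale1r.
  have [fF aw] := (smooth_section_scale fM twA, smooth_section_scale atf wA).
  by rewrite (labracket_bilinear L 1 fF aw sA).2 scale1r !labracket_leibniz.
have := labracket_leibniz_jacobi uA vA fwA p.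
rewrite labracket_leibniz // !E // (labracket_leibniz_jacobi uA vA wA).
set X := labracket L u (labracket L v w) p.
set Y := labracket L v (labracket L u w) p.
set P := labracket L v w p; set Q := labracket L u w p.
set a := anchor_act _ u f p; set b := anchor_act _ v f p.
set c := anchor_act _ u _ p; set d := anchor_act _ v _ p.
move=> H; apply/eqP; rewrite -subr_eq0.
have : (anchor_act (laanchor L) (labracket L u v) f p - (c - d)) *: w p = 0.
  apply/eqP; rewrite scalerBl subr_eq0; apply/eqP.
  apply: (addrI (f p *: (X - Y))); rewrite H !scalerBr scalerBl !opprD !addrA.
  rewrite [LHS](ACl ((1*5*4*8)*((2*7)*(3*6)))) /=.
  by rewrite !subrr !addr0.
by move=> /eqP; rewrite scaler_eq0 => /orP[//|/eqP].
Qed.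

End AnchorBracket.

(** * Jacobi identity and uniqueness for brackets satisfying the Schouten axioms *)

Section SchoutenBracket.
Variables (R : realType) (M : manifold R) (A : vector_bundle M).
Implicit Types (x y z : mvfield A) (k l m : int).

Inductive generator : int -> mvfield A -> Prop :=
| generator_fun f of smooth_fun f : generator 0 (mv_fun A f)
| generator_section u of smooth_section u : generator 1 (mv_section u).

Lemma mv_deg_generator k x : generator k x -> multivector_deg k x.
Proof. by case=> *; [apply: mv_deg_fun|apply: mv_deg_section]. Qed.

Lemma eq_derivation_generator d (D D' : mvfield A -> mvfield A) k x :
  graded_derivation d D -> graded_derivation d D' ->
  (forall l y, generator l y -> D y = D' y) ->
  multivector_deg k x -> D x = D' x.
Proof.
move=> DD DD' DE; apply: eq_derivation DD DD' _ _ => [f fM|u uA].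
  exact: DE (generator_fun fM).
exact: DE (generator_section uA).
Qed.

Section BracketTheory.
Variables (L : lie_algebroid A) (br : mvfield A -> mvfield A -> mvfield A).
Hypothesis H : schouten_axioms L br.

Lemma schouten_skew k l x y : multivector_deg k x -> multivector_deg l y ->
  br x y = fun p => - (-1) ^ ((k - 1) * (l - 1)) *: br y x p.
Proof.
move=> xk yl; apply/functional_extensionality_dep => p.
by rewrite (sb_skew H xk yl) scaleNr.
Qed.

Lemma schouten_derivation k x :
  multivector_deg k x -> graded_derivation (k - 1) (br x).
Proof.
move=> xk; have [xA _] := xk; split=> [a y z yA zA|l y yl|l m y z yl zm].
- apply/functional_extensionality_dep => p.
  by rewrite (sb_bilinear H a yA zA xA).2.
- by rewrite addrCA addrA; apply: (sb_degree H).
- by apply/functional_extensionality_dep => p; rewrite (sb_leibniz H xk yl zm).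
Qed.

Lemma schouten_lt0 k l x y : multivector_deg k x -> multivector_deg l y ->
  k + l < 1 -> br x y = fun=> 0.
Proof.
move=> xk yl kl; apply: mv_deg_lt0 (sb_degree H xk yl).
by rewrite subr_lt0.
Qed.

Lemma schouten_section u v : smooth_section u -> smooth_section v ->
  br (mv_section u) (mv_section v) = mv_section (labracket L u v).
Proof.
by move=> uA vA; apply/functional_extensionality_dep => p; apply: (sb_section H).
Qed.

Lemma schouten_section_fun u f : smooth_section u -> smooth_fun f ->
  br (mv_section u) (mv_fun A f) = mv_fun A (anchor_act (laanchor L) u f).
Proof.
move=> uA fM; apply/functional_extensionality_dep => p.
exact: (sb_section_fun H).
Qed.

(** The degrees are arguments because a field need not determine its degree: 0 has all of them. *)
Definition jacobiator k l m x y z : mvfield A := fun p =>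
  (-1) ^ ((k - 1) * (m - 1)) *: br x (br y z) p
  + (-1) ^ ((l - 1) * (k - 1)) *: br y (br z x) p
  + (-1) ^ ((m - 1) * (l - 1)) *: br z (br x y) p.

Lemma jacobiator_cyclic k l m x y z :
  jacobiator k l m x y z = jacobiator l m k y z x.
Proof.
by apply/functional_extensionality_dep => p; rewrite /jacobiator -addrA addrC.
Qed.

Lemma jacobiatorE k l m x y z :
  multivector_deg k x -> multivector_deg l y -> multivector_deg m z ->
  jacobiator k l m x y z = fun p => (-1) ^ ((k - 1) * (m - 1)) *:
    (br x (br y z) p - (-1) ^ ((k - 1) * (l - 1)) *: br y (br x z) p
     - br (br x y) z p).
Proof.
move=> xk yl zm; apply/functional_extensionality_dep => p; rewrite /jacobiator.
have xyk := sb_degree H xk yl.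
have [xzA _] := sb_degree H xk zm.
rewrite (schouten_skew zm xk) (gdZ (schouten_derivation yl)) //.
rewrite (schouten_skew zm xyk) scalerBr scalerBr !scalerA -!scalerN.
rewrite (_ : k + l - 1 - 1 = (k - 1) + (l - 1)); last by ring.
rewrite [(m - 1) * (k - 1 + (l - 1))]mulrDr signzD.
rewrite ![_ * (k - 1)]mulrC ![(m - 1) * (l - 1)]mulrC.
have := signz_sqr R ((l - 1) * (m - 1)).
move: ((-1) ^ ((k - 1) * (m - 1)) : R) ((-1) ^ ((k - 1) * (l - 1)) : R)
  ((-1) ^ ((l - 1) * (m - 1)) : R) => a b c cc.
apply/ffunP => I; do ?[rewrite ext_scaleE || rewrite ffunE].
by ring: cc.
Qed.

(** In this form the Jacobi identity equates two derivations applied to [z]: the bracket with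
    [x, y], and the graded commutator of the brackets with x and with y. *)
Lemma jacobiator_eq0P k l m x y z :
  multivector_deg k x -> multivector_deg l y -> multivector_deg m z ->
  jacobiator k l m x y z = (fun=> 0) <->
  br (br x y) z =
    fun p => br x (br y z) p - (-1) ^ ((k - 1) * (l - 1)) *: br y (br x z) p.
Proof.
move=> xk yl zm; rewrite (jacobiatorE xk yl zm).
split=> E; apply/functional_extensionality_dep => p.
  have /eqP := congr1 (fun v : mvfield A => v p) E.
  rewrite scaler_eq0 expfz_eq0 oppr_eq0 oner_eq0 andbF /= subr_eq0.
  by move=> /eqP ->.
by rewrite E subrr scaler0.
Qed.

(** Each double bracket has degree k + l + m - 2, which is negative. *)
Lemma jacobiator_lt0 k l m x y z :
  multivector_deg k x -> multivector_deg l y -> multivector_deg m z ->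
  k + l + m < 2 -> jacobiator k l m x y z = fun=> 0.
Proof.
move=> xk yl zm klm; apply/functional_extensionality_dep => p.
rewrite /jacobiator.
rewrite (schouten_lt0 xk (sb_degree H yl zm)); last by lia.
rewrite (schouten_lt0 yl (sb_degree H zm xk)); last by lia.
rewrite (schouten_lt0 zm (sb_degree H xk yl)); last by lia.
by rewrite !scaler0 !addr0.
Qed.

Lemma jacobiator_section_section_fun u v f :
  smooth_section u -> smooth_section v -> smooth_fun f ->
  jacobiator 1 1 0 (mv_section u) (mv_section v) (mv_fun A f) = fun=> 0.
Proof.
move=> uA vA fM; apply/(jacobiator_eq0P (mv_deg_section uA)
  (mv_deg_section vA) (mv_deg_fun A fM)).
have uvA := labracket_smooth L uA vA.
have auf : smooth_fun (anchor_act (laanchor L) u f) by apply: anchor_smooth.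
have avf : smooth_fun (anchor_act (laanchor L) v f) by apply: anchor_smooth.
rewrite schouten_section // !schouten_section_fun //.
apply/functional_extensionality_dep => p.
by rewrite /mv_fun anchor_bracket // subrr mul0r expr0z scale1r scalerBl.
Qed.

Lemma jacobiator_section u v w :
  smooth_section u -> smooth_section v -> smooth_section w ->
  jacobiator 1 1 1 (mv_section u) (mv_section v) (mv_section w) = fun=> 0.
Proof.
move=> uA vA wA; apply/(jacobiator_eq0P (mv_deg_section uA)
  (mv_deg_section vA) (mv_deg_section wA)).
have [uvA uwA] := (labracket_smooth L uA vA, labracket_smooth L uA wA).
have vwA := labracket_smooth L vA wA.
rewrite !schouten_section //; apply/functional_extensionality_dep => p.
rewrite /mv_section labracket_leibniz_jacobi // subrr mul0r expr0z scale1r.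
by rewrite -scaleN1r addrC ext_incl_lin scaleN1r addrC.
Qed.

Lemma jacobiator_generator k l m x y z :
  generator k x -> generator l y -> generator m z ->
  jacobiator k l m x y z = fun=> 0.
Proof.
move=> xg yg zg.
have xk := mv_deg_generator xg; have yl := mv_deg_generator yg.
have zm := mv_deg_generator zg.
have [|klm] := ltP (k + l + m) 2; first exact: jacobiator_lt0.
(* Total degree at least 2 leaves at most one function among the three, and a cyclic permutation
   puts it last. *)
case: xg yg zg klm {xk yl zm} => [f fM|u uA] [g gM|v vA] [h hM|w wA] //= _.
- by rewrite jacobiator_cyclic jacobiator_section_section_fun.
- by rewrite 2!jacobiator_cyclic jacobiator_section_section_fun.
- exact: jacobiator_section_section_fun.
- exact: jacobiator_section.
Qed.

Lemma jacobiator_extend k l x y :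
  multivector_deg k x -> multivector_deg l y ->
  (forall m z, generator m z -> jacobiator k l m x y z = fun=> 0) ->
  forall m z, multivector_deg m z -> jacobiator k l m x y z = fun=> 0.
Proof.
move=> xk yl J m z zm; apply/(jacobiator_eq0P xk yl zm).
have Dxy := schouten_derivation (sb_degree H xk yl).
(* The two derivations to be compared must carry the same degree syntactically. *)
rewrite (_ : k + l - 1 - 1 = (k - 1) + (l - 1)) in Dxy; last by ring.
have DD :=
  derivation_commutator (schouten_derivation xk) (schouten_derivation yl).
apply: (eq_derivation_generator Dxy DD _ zm) => n w wg.
exact/(jacobiator_eq0P xk yl (mv_deg_generator wg))/J.
Qed.

(* The cyclic invariance lets each of the three arguments in turn be the last
   one, in which the Jacobiator is a derivation. *)
Lemma schouten_jacobi k l m x y z :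
  multivector_deg k x -> multivector_deg l y -> multivector_deg m z ->
  jacobiator k l m x y z = fun=> 0.
Proof.
have gen := mv_deg_generator.
have J1 k1 l1 m1 x1 y1 z1 : generator k1 x1 -> generator l1 y1 ->
    multivector_deg m1 z1 -> jacobiator k1 l1 m1 x1 y1 z1 = fun=> 0.
  move=> xg yg; apply: jacobiator_extend; [exact: gen|exact: gen|].
  by move=> m2 z2; apply: jacobiator_generator.
have J2 k1 l1 m1 x1 y1 z1 : generator k1 x1 -> multivector_deg l1 y1 ->
    multivector_deg m1 z1 -> jacobiator k1 l1 m1 x1 y1 z1 = fun=> 0.
  move=> xg yl; apply: jacobiator_extend => // [|m2 z2 zg]; first exact: gen.
  by rewrite -jacobiator_cyclic; apply: J1.
move=> xk yl; apply: jacobiator_extend => // m2 z2 zg.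
by rewrite -jacobiator_cyclic; apply: J2.
Qed.

End BracketTheory.

(** Agreement on pairs of generators extends to an arbitrary second argument by the derivation
    property; skew symmetry exchanges the arguments, and a second extension frees the other one. *)
Lemma eq_schouten_deg L br br' k l x y :
  schouten_axioms L br -> schouten_axioms L br' ->
  multivector_deg k x -> multivector_deg l y -> br x y = br' x y.
Proof.
move=> H H'; have gen := mv_deg_generator.
have Er k1 x1 : multivector_deg k1 x1 ->
    (forall l1 y1, generator l1 y1 -> br x1 y1 = br' x1 y1) ->
    forall l1 y1, multivector_deg l1 y1 -> br x1 y1 = br' x1 y1.
  move=> xk E l1 y1; apply: (eq_derivation_generator _ _ E).
    exact: (schouten_derivation H xk).
  exact: (schouten_derivation H' xk).
have sk k1 l1 x1 y1 : multivector_deg k1 x1 -> multivector_deg l1 y1 ->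
    br y1 x1 = br' y1 x1 -> br x1 y1 = br' x1 y1.
  by move=> xk yl E; rewrite (schouten_skew H xk yl) (schouten_skew H' xk yl) E.
have E1 k1 l1 x1 y1 : generator k1 x1 -> generator l1 y1 ->
    br x1 y1 = br' x1 y1.
  have Euf u f : smooth_section u -> smooth_fun f ->
      br (mv_section u) (mv_fun A f) = br' (mv_section u) (mv_fun A f).
    move=> uA fM.
    by rewrite (schouten_section_fun H) // (schouten_section_fun H').
  move=> [f fM|u uA] [g gM|v vA].
  - have [fd gd] := (mv_deg_fun A fM, mv_deg_fun A gM).
    (* The axioms do not name the bracket of two functions; it is 0 because its degree is -1. *)
    by rewrite (schouten_lt0 H fd gd) // (schouten_lt0 H' fd gd).
  - by apply: (sk 0 1); [apply: mv_deg_fun|apply: mv_deg_section|apply: Euf].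
  - exact: Euf.
  - by rewrite (schouten_section H) // (schouten_section H').
move=> xk; apply: (Er _ _ xk) => l1 y1 yg.
apply: (sk _ _ _ _ xk (gen _ _ yg)).
apply: (Er _ _ (gen _ _ yg) _ _ _ xk) => k2 x2 x2g.
exact: E1 yg x2g.
Qed.

Lemma bilinear_sumr (op : mvfield A -> mvfield A -> mvfield A) n
    (F : 'I_n -> mvfield A) x p :
  mv_bilinear op -> multivector x -> (forall i, multivector (F i)) ->
  op x (fun q => \sum_i F i q) p = \sum_i op x (F i) p.
Proof.
move=> opB xA FA; elim: n F FA => [|n IHn] F FA.
  (* Bilinearity is given on combinations [a *: x + y] only, so the empty sum is written as such a
     combination. *)
  rewrite big_ord0 (_ : (fun q => _) = fun q => -1 *: x q + x q); last first.
    apply/functional_extensionality_dep => q.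
    by rewrite big_ord0 scaleN1r addNr.
  by rewrite (opB (-1) x x x xA xA xA).2 scaleN1r addNr.
rewrite big_ord_recl (_ : (fun q => _) =
    fun q => 1 *: F ord0 q + \sum_(i < n) F (lift ord0 i) q); last first.
  by apply/functional_extensionality_dep => q; rewrite big_ord_recl scale1r.
have FnA : multivector (fun q => \sum_(i < n) F (lift ord0 i) q).
  exact: multivector_sum.
by rewrite (opB 1 _ _ x (FA _) FnA xA).2 scale1r IHn.
Qed.

Lemma bilinear_suml (op : mvfield A -> mvfield A -> mvfield A) n
    (F : 'I_n -> mvfield A) y p :
  mv_bilinear op -> multivector y -> (forall i, multivector (F i)) ->
  op (fun q => \sum_i F i q) y p = \sum_i op (F i) y p.
Proof.
move=> opB; pose op' x y := op y x.
apply: (@bilinear_sumr op') => a u v w uA vA wA.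
by have [E1 E2] := opB a u v w uA vA wA.
Qed.

Lemma bilinear_comp (op : mvfield A -> mvfield A -> mvfield A) x y p :
  mv_bilinear op -> multivector x -> multivector y ->
  op x y p =
  \sum_(k < (rank A).+1) \sum_(l < (rank A).+1)
    op (mv_comp k x) (mv_comp l y) p.
Proof.
move=> opB xA yA.
have compE (z : mvfield A) : z = fun q => \sum_(k < (rank A).+1) mv_comp k z q.
  by apply/functional_extensionality_dep => q; apply: mv_comp_sum.
rewrite {1}(compE x) bilinear_suml // => [|k]; last exact: multivector_comp.
apply: eq_bigr => k _; rewrite {1}(compE y) bilinear_sumr // => [|l].
  exact: multivector_comp.
exact: multivector_comp.
Qed.

Lemma eq_schouten L br br' x y :
  schouten_axioms L br -> schouten_axioms L br' ->
  multivector x -> multivector y -> forall p, br' x y p = br x y p.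
Proof.
move=> H H' xA yA p; rewrite (bilinear_comp p (sb_bilinear H') xA yA).
rewrite (bilinear_comp p (sb_bilinear H) xA yA).
apply: eq_bigr => k _; apply: eq_bigr => l _.
by rewrite (eq_schouten_deg H' H (mv_deg_comp k xA) (mv_deg_comp l yA)).
Qed.

End SchoutenBracket.

(** * The graded commutator satisfies the Schouten axioms *)

Section GradedCommutator.
Variables (R : realType) (M : manifold R) (A : vector_bundle M).
Variable S : left_symmetric_algebroid A.
Variable dotS : mvfield A -> mvfield A -> mvfield A.
Hypothesis dotS_ext : schouten_extension S dotS.
Implicit Types (x y z : mvfield A) (k l : int).

Let dotB := se_bilinear dotS_ext.

Lemma mv_comp_lin (k : nat) (a : R) x y :
  mv_comp k (fun p => a *: x p + y p) =
  fun p => a *: mv_comp k x p + mv_comp k y p.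
Proof.
apply/functional_extensionality_dep => p.
by rewrite /mv_comp ext_compD ext_compZ.
Qed.

Lemma graded_commutator_bilinear : mv_bilinear (graded_commutator dotS).
Proof.
move=> a x y z xA yA zA.
split=> p; rewrite /graded_commutator scaler_sumr -big_split;
  apply: eq_bigr => k _; rewrite scaler_sumr -big_split; apply: eq_bigr => l _ /=;
  rewrite mv_comp_lin.
- have E := dotB a (multivector_comp k xA) (multivector_comp k yA)
    (multivector_comp l zA).
  by rewrite E.1 E.2 scalerDr opprD addrACA scalerBr !scalerA mulrC.
- have E := dotB a (multivector_comp l xA) (multivector_comp l yA)
    (multivector_comp k zA).
  by rewrite E.1 E.2 scalerDr opprD addrACA scalerBr !scalerA mulrC.
Qed.

Lemma graded_commutator_fun k l x y :
  multivector_deg k x -> multivector_deg l y ->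
  graded_commutator dotS x y =
  fun p => - (-1) ^ ((k - 1) * (l - 1)) *: dotS y x p + dotS x y p.
Proof.
move=> xk yl; apply/functional_extensionality_dep => p.
by rewrite (graded_commutatorE dotB xk yl) scaleNr addrC.
Qed.

Lemma graded_commutator_schouten :
  schouten_axioms (subadjacent S) (graded_commutator dotS).
Proof.
split.
- exact: graded_commutator_bilinear.
- move=> k l x y xk yl; rewrite (graded_commutator_fun xk yl).
  apply: mv_deg_lin; last exact: (se_degree dotS_ext).
  by rewrite (addrC k); apply: (se_degree dotS_ext).
- move=> k l x y xk yl p.
  rewrite (graded_commutatorE dotB xk yl) (graded_commutatorE dotB yl xk).
  rewrite [(l - 1) * _]mulrC scalerBr scalerA signz_sqr scale1r opprB.
  by [].
- move=> u v uA vA p.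
  rewrite (graded_commutatorE dotB (mv_deg_section uA) (mv_deg_section vA)).
  rewrite subrr mul0r expr0z scale1r !(se_section dotS_ext) //.
  rewrite /mv_section /= /commutator -scaleN1r addrC -ext_incl_lin scaleN1r.
  by rewrite addrC.
- move=> u f uA fM p.
  (* The product of a function with a section is 0 in this order, so only the anchor term
     survives. *)
  rewrite (graded_commutatorE dotB (mv_deg_section uA) (mv_deg_fun A fM)).
  rewrite (se_section_fun dotS_ext) // (se_fun_section dotS_ext) //.
  by rewrite scaler0 subr0.
- move=> k l m x y z xk yl zm p.
  rewrite (graded_commutatorE dotB xk (mv_deg_wedge yl zm)).
  rewrite (se_leibniz_r dotS_ext xk yl zm) (se_leibniz_l dotS_ext yl zm xk).
  rewrite (graded_commutator_fun xk yl) (graded_commutator_fun xk zm).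
  (* The right Leibniz rule expands x.(y^z) and the left one (y^z).x. With i = k - 1, all exponents
     are expressed through i, i(l - 1) and i(m - 1), so that only three signs remain. *)
  rewrite (_ : (k - 1) * (l + m - 1) = (k - 1) * (l - 1) + (k - 1) * m);
    last by ring.
  rewrite (_ : (k - 1) * l = (k - 1) * (l - 1) + (k - 1)); last by ring.
  rewrite (_ : (k - 1) * m = (k - 1) * (m - 1) + (k - 1)); last by ring.
  move: (k - 1) => i; rewrite /wedge !(ext_mulDl, ext_mulDr, ext_mulZl, ext_mulZr).
  rewrite !signzD; have := signz_sqr R i; have := signz_sqr R (i * (m - 1)).
  move: ((-1) ^ i : R) ((-1) ^ (i * (m - 1)) : R)
    ((-1) ^ (i * (l - 1)) : R) => a b c bb aa.
  move: (ext_mul (dotS x y p) _) (ext_mul (dotS y x p) _)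
    (ext_mul _ (dotS x z p)) (ext_mul _ (dotS z x p)).
  move=> v1 v2 v3 v4; apply/ffunP => I.
  do ?[rewrite ext_scaleE || rewrite ffunE].
  by ring: aa bb.
Qed.

End GradedCommutator.

Theorem theorem3p11 (R : realType) (M : manifold R) (A : vector_bundle M)
    (S : left_symmetric_algebroid A)
    (dotS : mvfield A -> mvfield A -> mvfield A)
    (dotS_ext : schouten_extension S dotS) :
  graded_lie_admissible dotS /\
  is_schouten_bracket (subadjacent S) (graded_commutator dotS).
Proof.
have H := graded_commutator_schouten dotS_ext.
(* An operation of degree -1 on V(A) has degree 0 for the shifted grading. *)
have shiftE (i j : int) : (i + 1) + (j + 1) - 1 = i + j + 1 by ring.
split; last by split=> // br' H' x y xA yA p; apply: eq_schouten H H' xA yA p.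
split.
  split=> [|i j x y xi yj]; first exact: (se_bilinear dotS_ext).
  by rewrite /shifted_deg -shiftE; apply: (se_degree dotS_ext).
split=> [|i j x y xi yj p|i j k x y z xi yj zk p].
- split=> [|i j x y xi yj]; first exact: (sb_bilinear H).
  by rewrite /shifted_deg -shiftE; apply: (sb_degree H).
- by rewrite (sb_skew H xi yj) !addrK.
have := congr1 (fun v : mvfield A => v p) (schouten_jacobi H xi yj zk).
by rewrite /jacobiator !addrK.
Qed.
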